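(* Let $G\subset\mathbb{R}^n$ be a compact convex set with non-empty interior, let $\mathcal{K}(G)$ denote the set of all compact convex subsets of $G$, and for $K,L\in\mathcal{K}(G)$ let $$d_G(K,L) := \sum_{j=0}^{n}\Big( 2\,\mathrm{MV}_j(G, K\,\widetilde{\cup}\, L) - \mathrm{MV}_j(G,K) - \mathrm{MV}_j(G,L)\Big).$$ Then: (i) for any $\beta>1$ there is no $C>0$ such that $d_G(K,L)\le C\, d_{\mathcal H}(K,L)^\beta$ for all $K,L\in\mathcal{K}(G)$; (ii) for any $p<\frac{n+1}{2}$ there is no $C>0$ such that $C\, d_{\mathcal H}(K,L)^p\le d_G(K,L)$ for all $K,L\in\mathcal{K}(G)$; (iii) if $G$ is a convex polytope, then for any $p<n$ there is no $C>0$ such that $C\, d_{\mathcal H}(K,L)^p\le d_G(K,L)$ for all $K,L\in\mathcal{K}(G)$.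
   Context: $K\,\widetilde{\cup}\,L$ denotes the closed convex hull of $K\cup L$. $d_{\mathcal H}$ is the Hausdorff distance: $d_{\mathcal H}(K,L)=\inf\{\delta>0: K\subset L+\delta B,\ L\subset K+\delta B\}$, where $B$ is the closed unit ball centered at the origin. The mixed volume $\mathrm{MV}(K_1,\dots,K_n)$ of compact convex sets $K_1,\dots,K_n\subset\mathbb{R}^n$ is the unique symmetric function such that $\mathrm{Vol}(t_1K_1+\cdots+t_nK_n)=\sum_{i_1,\dots,i_n=1}^n t_{i_1}\cdots t_{i_n}\mathrm{MV}(K_{i_1},\dots,K_{i_n})$ for all $t_1,\dots,t_n\ge 0$. $\mathrm{MV}_j(G,K):=\mathrm{MV}(G,\dots,G,K,\dots,K)$ with $G$ appearing $n-j$ times and $K$ appearing $j$ times. *)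

(* Defs.v *)
From HB Require Import structures.
From mathcomp Require Import all_boot all_order all_algebra all_fingroup.
From mathcomp Require Import all_classical all_reals all_analysis.
From Stdlib Require Import ClassicalEpsilon.
Set Implicit Arguments. Unset Strict Implicit. Unset Printing Implicit Defensive.
Import Order.TTheory GRing.Theory Num.Theory.
Import numFieldNormedType.Exports.
Local Open Scope classical_set_scope.
Local Open Scope ring_scope.

Section Defs.
Variable R : realType.

(* Points of R^n are row vectors 'rV[R]_n (product topology = Euclidean topology). *)

Definition enorm n (x : 'rV[R]_n) : R := Num.sqrt (\sum_(i < n) x ord0 i ^+ 2).

Definition convex n (A : set 'rV[R]_n) : Prop :=
  forall x y (t : R), A x -> A y -> 0 <= t -> t <= 1 -> A (t *: x + (1 - t) *: y).

Definition cc_body n (K : set 'rV[R]_n) : Prop :=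
  K !=set0 /\ compact K /\ convex K.

Definition in_KG n (G K : set 'rV[R]_n) : Prop := cc_body K /\ K `<=` G.

Definition mink_comb n m (t : 'I_m -> R) (K : 'I_m -> set 'rV[R]_n) : set 'rV[R]_n :=
  [set x | exists y : 'I_m -> 'rV[R]_n,
      (forall i, K i (y i)) /\ x = \sum_(i < m) t i *: y i].

(* n-dimensional Lebesgue volume, defined by iterated one-dimensional
   Lebesgue integration (Cavalieri/Fubini) *)
Fixpoint vol_e (n : nat) : set 'rV[R]_n -> \bar R :=
  match n return set 'rV[R]_n -> \bar R with
  | 0 => fun A => if `[< A !=set0 >] then 1%E else 0%E
  | k.+1 => fun A =>
      (\int[@lebesgue_measure R]_(x in [set: R])
          vol_e [set y : 'rV[R]_k | A (row_mx (\row_(_ < 1) x) y)])%E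
  end.

Definition Vol n (A : set 'rV[R]_n) : R := fine (vol_e A).

Definition is_mixed_volume n (MV : ('I_n -> set 'rV[R]_n) -> R) : Prop :=
  (forall (s : 'S_n) (K : 'I_n -> set 'rV[R]_n),
      (forall i, cc_body (K i)) -> MV (K \o s) = MV K) /\
  (forall (K : 'I_n -> set 'rV[R]_n) (t : 'I_n -> R),
      (forall i, cc_body (K i)) -> (forall i, 0 <= t i) ->
      Vol (mink_comb t K) =
      \sum_(f : {ffun 'I_n -> 'I_n}) (\prod_(k < n) t (f k)) * MV (fun k => K (f k))).

(* the mixed volume: the (unique on convex bodies) symmetric function above *)
Definition MV n : ('I_n -> set 'rV[R]_n) -> R :=
  epsilon (inhabits (fun _ => 0)) (@is_mixed_volume n).

Definition MVj n (j : nat) (G K : set 'rV[R]_n) : R :=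
  MV (fun k : 'I_n => if (k < n - j)%N then G else K).

Definition cconv_union n (K L : set 'rV[R]_n) : set 'rV[R]_n :=
  \bigcap_(C in [set C : set 'rV[R]_n | closed C /\ convex C /\ (K `|` L) `<=` C]) C.

Definition dG n (G K L : set 'rV[R]_n) : R :=
  \sum_(0 <= j < n.+1)
     (2 * MVj j G (cconv_union K L) - MVj j G K - MVj j G L).

Definition thicken n (A : set 'rV[R]_n) (d : R) : set 'rV[R]_n :=
  [set x | exists2 y, A y & enorm (x - y) <= d].

Definition dH n (K L : set 'rV[R]_n) : R :=
  inf [set d : R | 0 < d /\ K `<=` thicken L d /\ L `<=` thicken K d].

Definition conv_hull_seq n (s : seq 'rV[R]_n) : set 'rV[R]_n :=
  [set x | exists w : 'rV[R]_n -> R,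
     (forall v, 0 <= w v) /\ \sum_(v <- s) w v = 1 /\
     x = \sum_(v <- s) w v *: v].

Definition polytope n (G : set 'rV[R]_n) : Prop :=
  exists s : seq 'rV[R]_n, G = conv_hull_seq s.

End Defs.

(* Main.v *)
Require Import Defs.
From HB Require Import structures.
From mathcomp Require Import all_boot all_order all_algebra all_fingroup finmap.
From mathcomp Require Import all_classical all_reals all_analysis.
From mathcomp Require Import measurable_realfun ring lra.
From Stdlib Require Import ClassicalEpsilon.
Set Implicit Arguments. Unset Strict Implicit. Unset Printing Implicit Defensive.
Import Order.TTheory GRing.Theory Num.Theory.
Import numFieldNormedType.Exports.
Local Open Scope classical_set_scope.
Local Open Scope ring_scope.

(* Minkowski's theorem.  For polytopes K_i the integral of a polynomial over
   t_1 K_1 + ... + t_m K_m is a homogeneous polynomial in t: integrating out the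
   first coordinate evaluates an antiderivative on the upper and on the lower
   boundary, which are affine over finitely many cells; the cells are again
   Minkowski combinations of polytopes and overlap in null sets, so induction on
   the dimension applies.  Polarization recovers the coefficients of such a
   polynomial from finitely many values, hence the resulting identity passes to
   limits and, through outer polytopal approximation, holds for all bodies.

   The bounds.  For L inside G, polarization and monotonicity of volume bound
   d_G(G, L) by a constant times Vol G - Vol L.  Cutting off from G a cap of
   height s gives d_H(G, L) >= c s and d_G(G, L) = O(volume of the cap).  The cap
   has volume O(s^((n+1)/2)) at a point where a paraboloid touches G from outside
   (a maximiser of K x_1 + |x|^2), and O(s^n) at a vertex of a polytope.  For (i),
   L is a copy of G shrunk by the factor 1 - e: then d_G(G, L) >= e Vol G while
   d_H(G, L) = O(e). *)

(** [MV] is picked by [epsilon], so nothing is known about it until some mixed volume is shown to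
    exist; this is why Minkowski's theorem has to be proved at all. Afterwards polarization
    expresses [MV] through volumes alone. Volumes alone do not carry the induction on the dimension:
    the length of a vertical section depends on the remaining coordinates, so the statement must
    cover polynomial integrands, homogeneous in t and the point together, as the boundary heights
    are. All counterexamples take K = G. The hull of the union is then G, and d_G(G, L) is the sum
    of the differences MV_j(G, G) - MV_j(G, L). The exponents come from the shape of a cap of height
    s: under a paraboloid, n - 1 directions have width of order s^(1/2) and one has width of order
    s, and (n - 1)/2 + 1 = (n + 1)/2; at a vertex all n widths are of order s. *)

(* Mathcomp-Analysis exports [m1 \x m2] as a sigma-finite measure only when
   both factors are subprobabilities. *)
Section ProductSigmaFinite.
Variable R : realType.
Context d1 (T1 : measurableType d1) (m1 : {sigma_finite_measure set T1 -> \bar R}).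
Context d2 (T2 : measurableType d2) (m2 : {sigma_finite_measure set T2 -> \bar R}).

Definition sf_prod := (m1 \x m2)%E.

HB.instance Definition _ := Measure.on sf_prod.

Lemma sf_prod_sigma_finite : sigma_finite setT sf_prod.
Proof.
have /sigma_finiteP[F [TF ndF Foo]] := sigma_finiteT m1.
have /sigma_finiteP[G [TG ndG Goo]] := sigma_finiteT m2.
exists (fun k => F k `*` G k) => [|k].
  apply/esym; rewrite -subTset => -[x y] _.
  have [i _ Fx] : (\bigcup_i F i) x by rewrite -TF.
  have [j _ Gy] : (\bigcup_i G i) y by rewrite -TG.
  exists (i + j)%N => //; split.
    by move: Fx; apply/subsetPset/ndF/leq_addr.
  by move: Gy; apply/subsetPset/ndG/leq_addl.
have [mF Fk] := Foo k; have [mG Gk] := Goo k.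
split; first exact: measurableX.
by rewrite /sf_prod product_measure1E// lte_mul_pinfty// ge0_fin_numE.
Qed.

HB.instance Definition _ :=
  Measure_isSigmaFinite.Build _ _ _ sf_prod sf_prod_sigma_finite.

End ProductSigmaFinite.

(** * Lebesgue measure on row vectors *)

Section Space.
Variable R : realType.

(** The same [row_mx] as in [vol_e], so that the two agree by conversion. *)
Definition consv n (x : R) (y : 'rV[R]_n) : 'rV[R]_n.+1 :=
  row_mx (\row_(_ < 1) x) y.

Lemma consv0 n x (y : 'rV[R]_n) : consv x y 0 ord0 = x.
Proof. by rewrite mxE; case: splitP => [j _|//]; rewrite mxE. Qed.

Lemma consvS n x (y : 'rV[R]_n) i : consv x y 0 (lift ord0 i) = y 0 i.
Proof.
rewrite mxE; case: splitP => [[[]]//|j /= [ij]].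
by congr (y _ _); exact/val_inj.
Qed.

Definition behv n (v : 'rV[R]_n.+1) : 'rV[R]_n := \row_i v 0 (lift ord0 i).

Lemma consv_behv n (v : 'rV[R]_n.+1) : consv (v 0 ord0) (behv v) = v.
Proof.
by apply/rowP => i; case: (unliftP ord0 i) => [j|] ->;
  rewrite ?consv0 ?consvS ?mxE.
Qed.

Lemma consvK n x (y : 'rV[R]_n) : behv (consv x y) = y.
Proof. by apply/rowP => i; rewrite mxE consvS. Qed.

Lemma sum_consv n x (y : 'rV[R]_n) (F : 'I_n.+1 -> R -> R) :
  \sum_i F i (consv x y 0 i) = F ord0 x + \sum_i F (lift ord0 i) (y 0 i).
Proof.
rewrite big_ord_recl consv0; congr (_ + _).
by apply: eq_bigr => i _; rewrite consvS.
Qed.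

(* Nested products [R * (R * ...)], peeling off the first coordinate as [vol_e]
   does; [emb] identifies them with row vectors. *)
Fixpoint sp_disp (n : nat) : measure_display :=
  if n is k.+1 then ((@measurable R.-ocitv (ocitv_type R)).-sigma, sp_disp k).-prod%mdisp
  else default_measure_display.

Fixpoint sp (n : nat) : measurableType (sp_disp n) :=
  match n return measurableType (sp_disp n) with
  | 0 => unit : measurableType _
  | k.+1 => (measurableTypeR R * sp k)%type : measurableType _
  end.

Fixpoint mu (n : nat) : {sigma_finite_measure set (sp n) -> \bar R} :=
  match n return {sigma_finite_measure set (sp n) -> \bar R} with
  | 0 => \d_tt : {sigma_finite_measure set unit -> \bar R}
  | k.+1 => sf_prod (@lebesgue_measure R) (mu k)
              : {sigma_finite_measure set (measurableTypeR R * sp k)%type -> \bar R}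
  end.

Fixpoint emb (n : nat) : sp n -> 'rV[R]_n :=
  match n return sp n -> 'rV[R]_n with
  | 0 => fun _ => 0
  | k.+1 => fun w => consv w.1 (emb w.2)
  end.

Lemma muS n (A : set (sp n.+1)) :
  mu n.+1 A = (\int[@lebesgue_measure R]_x mu n [set y | A (x, y)])%E.
Proof.
apply: eq_integral => x _ /=; congr (mu n _).
by apply/seteqP; split => y /=; rewrite /xsection /= inE.
Qed.

(** Holds for arbitrary [A]: the product measure is by definition the integral of the measures of
    the sections, so both sides are the same iterated integral. *)
Lemma vol_eE n (A : set 'rV[R]_n) : vol_e A = mu n (@emb n @^-1` A).
Proof.
elim: n A => [A|n IH A]; last first.
  by rewrite muS /=; apply: eq_integral => x _; rewrite IH.
suff AE : `[< A !=set0 >] = (tt \in @emb 0 @^-1` A).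
  by rewrite /vol_e AE /= diracE; case: (_ \in _).
apply/asboolP/idP => [[v]|]; last by rewrite inE => A0; exists 0.
by rewrite inE /= (_ : v = 0)//; apply/rowP => -[].
Qed.

Lemma measurable_emb n i : measurable_fun setT (fun w : sp n => emb w 0 i).
Proof.
elim: n i => [[]//|n IH i] /=.
case: (unliftP ord0 i) => [j|] ->; last first.
  under eq_fun do rewrite consv0; exact: measurable_fst.
under eq_fun do rewrite consvS.
apply: (measurableT_comp (IH j)); exact: measurable_snd.
Qed.
End Space.

(** * Measurability of compact sets and volumes of boxes *)

Section CompactMeasurability.
Variable R : realType.

Lemma exists_natinv_lt (r : R) : 0 < r -> exists k : nat, k.+1%:R^-1 < r.
Proof.
move=> r0; exists (Num.truncn r^-1).
by rewrite invf_plt ?posrE ?ltr0n// truncnS_gt.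
Qed.

Lemma rv_normP n (v : 'rV[R]_n) e : 0 <= e ->
  (`|v| <= e) <-> (forall i, `|v 0 i| <= e).
Proof.
move=> e0; have -> : `|v| = \big[Num.max/0]_ij `|v ij.1 ij.2| := mx_normrE v.
split => [/bigmax_leP[_ ve] i|ve].
  exact: (ve (0, i)).
apply/bigmax_leP; split => // -[i j] _ /=; rewrite ord1; exact: ve.
Qed.

Lemma rv_norm_coord n (v : 'rV[R]_n) i : `|v 0 i| <= `|v|.
Proof. exact: (rv_normP v (normr_ge0 v)).1. Qed.

Lemma compact_net n (A : set 'rV[R]_n) (e : R) : 0 < e -> compact A ->
  exists s : seq 'rV[R]_n, (forall x, x \in s -> A x) /\
    forall y, A y -> exists2 x, x \in s & `|y - x| < e.
Proof.
move=> e0; rewrite compact_cover => /(_ _ A (fun x => ball x e)) [].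
- by move=> x _; exact: ball_open.
- by move=> x Ax; exists x => //; exact: ballxx.
move=> D DA AD; exists (enum_fset D); split => [x xD|y /AD[x xD xy]].
  by have := DA x xD; rewrite inE.
exists x => //; move: xy; rewrite -ball_normE /ball_ /= distrC.
by [].
Qed.

Definition box n (a b : 'rV[R]_n) : set 'rV[R]_n :=
  [set v | forall i, a 0 i <= v 0 i <= b 0 i].

Lemma boxS n (a b : 'rV[R]_n.+1) :
  @emb R n.+1 @^-1` box a b =
  `[a 0 ord0, b 0 ord0]%classic `*` (@emb R n @^-1` box (behv a) (behv b)).
Proof.
apply/seteqP; split => -[x w] /=.
  move=> h; split => [|i]; first by have := h ord0; rewrite consv0 in_itv.
  by have := h (lift ord0 i); rewrite consvS !mxE.
move=> [+ h] i; rewrite in_itv /= => xab.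
case: (unliftP ord0 i) => [j|] ->; rewrite ?consv0 ?consvS//.
by have := h j; rewrite !mxE.
Qed.

Lemma measurable_box n (a b : 'rV[R]_n) : measurable (@emb R n @^-1` box a b).
Proof.
elim: n a b => [|n IH] a b; first by [].
by rewrite boxS; apply: measurableX => //; exact: measurable_itv.
Qed.

Lemma mu_box n (a b : 'rV[R]_n) : (forall i, a 0 i <= b 0 i) ->
  mu R n (@emb R n @^-1` box a b) = (\prod_i (b 0 i - a 0 i))%:E.
Proof.
elim: n a b => [|n IH] a b ab.
  rewrite big_ord0 /= diracE mem_set//; by case.
rewrite boxS [LHS]product_measure1E//; [|exact: measurable_box].
rewrite IH => [|i]; last by rewrite !mxE.
rewrite big_ord_recl EFinM; congr (_ * _)%E; last first.
  by congr (_%:E); apply: eq_bigr => i _; rewrite !mxE.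
rewrite [LHS](@lebesgue_measure_itv R) /= lte_fin.
have [//|ba] := ltP; rewrite (_ : b _ _ = a 0 ord0) ?subrr//.
by apply/eqP; rewrite eq_le ba ab.
Qed.

(** The sigma-algebra on [sp] is generated by products, not by open sets. A compact set is recovered
    as a countable intersection of finite unions of boxes centred at ever finer nets. *)
Lemma measurable_compact n (A : set 'rV[R]_n) : compact A ->
  measurable (@emb R n @^-1` A).
Proof.
move=> cA.
pose e (k : nat) : R := k.+1%:R^-1.
have e0 k : 0 < e k by rewrite invr_gt0.
have [s sP] := boolp.choice (fun k => compact_net (e0 k) cA).
have -> : A = \bigcap_k \bigcup_(x in [set` s k])
     box (x - const_mx (e k)) (x + const_mx (e k)).
  apply/seteqP; split => [y Ay k _|y yA].
    have [x xs xy] := (sP k).2 y Ay; exists x => // i; rewrite !mxE.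
    have := le_trans (rv_norm_coord (y - x) i) (ltW xy).
    by rewrite !mxE ler_distl.
  apply: (compact_closed (@norm_hausdorff _ _) cA).
  move=> B /nbhs_ballP[r r0 rB].
  have [k kr] := exists_natinv_lt r0.
  have [x /= xs xy] := yA k I; exists x; split; first exact: (sP k).1.
  apply: rB; rewrite -ball_normE /ball_ /=; apply: le_lt_trans kr.
  apply/rv_normP => [|i]; first exact: ltW.
  by have := xy i; rewrite !mxE ler_distl.
rewrite preimage_bigcap; apply: bigcap_measurable => // k _.
rewrite preimage_bigcup; apply: fin_bigcup_measurable => [|x _].
  exact: finite_seq.
exact: measurable_box.
Qed.

End CompactMeasurability.

(** * Null hyperplanes and translation invariance *)

Section NullSetsTranslations.
Variable R : realType.

Lemma measurable_linear n (b : 'rV[R]_n) :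
  measurable_fun setT (fun w : sp R n => \sum_i b 0 i * emb w 0 i).
Proof.
apply: measurable_sum => i.
by apply: measurable_funM => //; exact: measurable_emb.
Qed.

Lemma measurable_hyperplane n (b : 'rV[R]_n) c :
  measurable [set w : sp R n | \sum_i b 0 i * emb w 0 i = c].
Proof.
rewrite -[X in measurable X]setTI.
exact: (measurable_linear b measurableT (measurable_set1 c)).
Qed.

(** If the tail of [b] is nonzero, every section is a hyperplane and induction applies. Otherwise
    the set is a single value of the first coordinate times the whole space. *)
Lemma mu_hyperplane n (b : 'rV[R]_n) c : b != 0 ->
  mu R n [set w | \sum_i b 0 i * emb w 0 i = c] = 0%E.
Proof.
elim: n b c => [|n IH] b c b0.
  by case/eqP: b0; apply/rowP => -[].
have secE x : [set y : sp R n | [set w : sp R n.+1 | \sum_i b 0 i * emb w 0 i = c] (x, y)]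
    = [set y | \sum_i behv b 0 i * emb y 0 i = c - b 0 ord0 * x].
  have E y : \sum_i b 0 i * @emb R n.+1 (x, y) 0 i =
      b 0 ord0 * x + \sum_i behv b 0 i * emb y 0 i.
    rewrite [LHS](sum_consv x (emb y) (fun i z => b 0 i * z)); congr (_ + _).
    by apply: eq_bigr => i _; rewrite !mxE.
  apply/seteqP; split => y; rewrite /mkset E.
    by move=> <-; rewrite addrAC subrr add0r.
  by move=> ->; rewrite addrCA subrr addr0.
have [b'0|b'0] := eqVneq (behv b) 0; last first.
  rewrite muS; apply: integral0_eq => x _.
  by rewrite secE; exact: IH.
have b00 : b 0 ord0 != 0.
  apply: contra b0 => /eqP b00; apply/eqP.
  rewrite -(consv_behv b) b00 b'0; apply/rowP => i.
  by case: (unliftP ord0 i) => [j|] ->; rewrite ?consv0 ?consvS !mxE.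
have -> : [set w : sp R n.+1 | \sum_i b 0 i * emb w 0 i = c]
    = [set c / b 0 ord0] `*` setT.
  apply/seteqP; split => -[x y].
    have := secE x => /(congr1 (fun A => A y)) /= ->.
    rewrite b'0 big1 => [|i _]; last by rewrite mxE mul0r.
    by move/esym/eqP; rewrite subr_eq0 => /eqP ->; rewrite mulrAC divff ?mul1r.
  have := secE x => /(congr1 (fun A => A y)) /= -> [-> _].
  rewrite b'0 big1 => [|i _]; last by rewrite mxE mul0r.
  by rewrite mulrC divfK// subrr.
rewrite [LHS]product_measure1E//.
by rewrite [X in (X * _)%E](lebesgue_measure_set1) mul0e.
Qed.

(** The push-forward of Lebesgue measure under a translation agrees with it on half-open intervals,
    which determines the measure. *)
Lemma lebesgue_integral_translate (f : measurableTypeR R -> \bar R) (c : R) :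
  measurable_fun setT f -> (forall x, 0 <= f x)%E ->
  (\int[@lebesgue_measure R]_x f (x - c)%R = \int[@lebesgue_measure R]_x f x)%E.
Proof.
move=> mf f0.
have mph : measurable_fun setT (fun x : measurableTypeR R => (x - c)%R : measurableTypeR R).
  by apply: measurable_funB => //; exact: measurable_id.
pose g : {mfun measurableTypeR R >-> measurableTypeR R} :=
  HB.pack (fun x : measurableTypeR R => (x - c)%R : measurableTypeR R)
   (isMeasurableFun.Build _ _ _ _ _ mph).
transitivity (\int[pushforward (@lebesgue_measure R) g]_x f x)%E.
  by rewrite (@ge0_integral_pushforward _ _ _ _ R g).
apply: eq_measure_integral => A mA _.
apply/esym/(lebesgue_measure_unique (mu := pushforward lebesgue_measure g)) => //.
move=> _ [[a b] _ <-] /=; rewrite /pushforward.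
have -> : g @^-1` `]a, b] = `](a + c), (b + c)]%classic.
  by apply/seteqP; split => x /=; rewrite !in_itv/= ltrBrDr lerBlDr.
rewrite !lebesgue_measure_itv /= !lte_fin ltrD2r.
by case: ifP => // _; rewrite -!EFinB; congr (_%:E); ring.
Qed.

Lemma mu_translate n (c : 'rV[R]_n) (A : set 'rV[R]_n) :
  measurable (@emb R n @^-1` A) ->
  mu R n (@emb R n @^-1` [set v | A (v - c)]) = mu R n (@emb R n @^-1` A).
Proof.
elim: n c A => [|n IH] c A mA.
  congr (mu R 0 _); apply/seteqP; split => -[] /=; by rewrite (_ : - c = 0) ?addr0//; apply/rowP => -[].
rewrite !muS.
have msec x : measurable [set y | (@emb R n.+1 @^-1` A) (x, y)].
  have := measurable_xsection x mA; rewrite /xsection.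
  by congr measurable; apply/seteqP; split => y /=; rewrite inE.
pose F (x : measurableTypeR R) := mu R n [set y | (@emb R n.+1 @^-1` A) (x, y)].
transitivity (\int[@lebesgue_measure R]_x F (x - c 0 ord0)%R)%E; last first.
  apply: lebesgue_integral_translate => //.
  have := measurable_fun_xsection (mu R n) mA.
  congr measurable_fun; apply/funext => x; congr (mu R n _).
  by apply/seteqP; split => y /=; rewrite /xsection /= inE.
apply: eq_integral => x _.
apply: etrans (IH (behv c) [set y | A (consv (x - c 0 ord0) y)] (msec _)).
have E y : consv x (emb y) - c = consv (x - c 0 ord0) (emb y - behv c).
  by apply/rowP => i; case: (unliftP ord0 i) => [j|] ->;
    rewrite ?consv0 ?consvS [LHS]mxE ?consv0 ?consvS !mxE.
by congr (mu R n _); apply/seteqP; split => y /=; rewrite E.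
Qed.

End NullSetsTranslations.

(** * Polynomials homogeneous jointly in coefficients and point *)

Section HomogeneousPolynomials.
Variable R : realType.

(** The degree counts the coefficients [t] and the point [y] together: boundary heights have degree
    1 in this sense, and once all coordinates of [y] are integrated out, only a form in [t] remains.
    Zero belongs to every degree, so that empty sums do. *)
Inductive hpoly m n : nat -> (('I_m -> R) -> 'rV[R]_n -> R) -> Prop :=
| hpoly0 d : hpoly d (fun _ _ => 0)
| hpolyC c : hpoly 0 (fun _ _ => c)
| hpolyT i : hpoly 1 (fun t _ => t i)
| hpolyY i : hpoly 1 (fun _ y => y 0 i)
| hpolyD d p q : hpoly d p -> hpoly d q -> hpoly d (fun t y => p t y + q t y)
| hpolyM d e p q : hpoly d p -> hpoly e q ->
    hpoly (d + e) (fun t y => p t y * q t y).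

Lemma hpolyZ m n d c (q : ('I_m -> R) -> 'rV[R]_n -> R) :
  hpoly d q -> hpoly d (fun t y => c * q t y).
Proof. by move=> hq; exact: (hpolyM (hpolyC _ _ c) hq). Qed.

Lemma hpolyN m n d (q : ('I_m -> R) -> 'rV[R]_n -> R) :
  hpoly d q -> hpoly d (fun t y => - q t y).
Proof.
move=> /(hpolyZ (-1)); congr hpoly.
by apply/funext => t; apply/funext => y; rewrite mulN1r.
Qed.

Lemma hpolyX m n d (q : ('I_m -> R) -> 'rV[R]_n -> R) k :
  hpoly d q -> hpoly (k * d) (fun t y => q t y ^+ k).
Proof.
move=> hq; elim: k => [|k IH]; first exact: (hpolyC _ _ 1).
have -> : (fun t y => q t y ^+ k.+1) = (fun t y => q t y * q t y ^+ k).
  by apply/funext => t; apply/funext => y; rewrite exprS.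
by rewrite mulSn; exact: hpolyM.
Qed.

Lemma hpoly_sum m n d (I : Type) (r : seq I) (P : pred I)
    (q : I -> ('I_m -> R) -> 'rV[R]_n -> R) :
  (forall i, P i -> hpoly d (q i)) ->
  hpoly d (fun t y => \sum_(i <- r | P i) q i t y).
Proof.
move=> hq; elim: r => [|i r IH].
  have -> : (fun t y => \sum_(i <- [::] | P i) q i t y) = (fun _ _ => 0).
    by apply/funext => t; apply/funext => y; rewrite big_nil.
  exact: hpoly0.
have [Pi|Pi] := boolP (P i).
  have -> : (fun t y => \sum_(j <- i :: r | P j) q j t y) =
            (fun t y => q i t y + \sum_(j <- r | P j) q j t y).
    by apply/funext => t; apply/funext => y; rewrite big_cons Pi.
  exact: hpolyD (hq _ Pi) IH.
move: IH; congr hpoly; apply/funext => t; apply/funext => y.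
by rewrite big_cons (negbTE Pi).
Qed.

(** Serves to evaluate an antiderivative on the boundary; the degree is kept because the substituted
    height has degree 1. *)
Lemma hpoly_subst m n d (q : ('I_m -> R) -> 'rV[R]_n.+1 -> R) l :
  hpoly d q -> hpoly 1 l -> hpoly d (fun t y => q t (consv (l t y) y)).
Proof.
move=> + hl; elim => {d q}.
- by move=> d; exact: hpoly0.
- by move=> c; exact: hpolyC.
- by move=> i; exact: hpolyT.
- move=> i; case: (unliftP ord0 i) => [j|] ->.
    have := hpolyY m j.
    by congr hpoly; apply/funext => t; apply/funext => y; rewrite consvS.
  by move: hl; congr hpoly; apply/funext => t; apply/funext => y; rewrite consv0.
- by move=> d p q _ hp _ hq; exact: hpolyD.
- by move=> d e p q _ hp _ hq; exact: hpolyM.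
Qed.

Lemma measurable_hpoly m n d (q : ('I_m -> R) -> 'rV[R]_n -> R) t :
  hpoly d q -> measurable_fun setT (fun w : sp R n => q t (emb w)).
Proof.
elim => {d q} //=.
- by move=> i; exact: measurable_emb.
- by move=> d p q _ hp _ hq; exact: measurable_funD.
- by move=> d e p q _ hp _ hq; exact: measurable_funM.
Qed.

Lemma hpoly_bounded m n d (q : ('I_m -> R) -> 'rV[R]_n -> R) t r :
  hpoly d q -> exists M, forall y, `|y| <= r -> `|q t y| <= M.
Proof.
elim => {d q}.
- by move=> _; exists 0 => y _; rewrite normr0.
- by move=> c; exists `|c|.
- by move=> i; exists `|t i|.
- by move=> i; exists r => y; apply: le_trans (rv_norm_coord _ _).
- move=> d p q _ [M hM] _ [N hN]; exists (M + N) => y yr.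
  by rewrite (le_trans (ler_normD _ _))// lerD ?hM ?hN.
- move=> d e p q _ [M hM] _ [N hN]; exists (M * N) => y yr.
  by rewrite normrM ler_pM ?hM ?hN.
Qed.

(* Normal form by powers of the first coordinate, used to find antiderivatives. *)
Inductive zpoly m n (d : nat) : (('I_m -> R) -> 'rV[R]_n.+1 -> R) -> Prop :=
| zpoly0 : zpoly d (fun _ _ => 0)
| zpolyZ k e c : (k + e)%N = d -> hpoly e c ->
    zpoly d (fun t v => v 0 ord0 ^+ k * c t (behv v))
| zpolyD p q : zpoly d p -> zpoly d q -> zpoly d (fun t v => p t v + q t v).

Lemma zpolyM m n d e (p q : ('I_m -> R) -> 'rV[R]_n.+1 -> R) :
  zpoly d p -> zpoly e q -> zpoly (d + e) (fun t v => p t v * q t v).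
Proof.
elim => {p}.
- move=> _; under eq_fun do under eq_fun do rewrite mul0r; exact: zpoly0.
- move=> k d' c dE hc; elim => {q}.
  + under eq_fun do under eq_fun do rewrite mulr0; exact: zpoly0.
  + move=> l e' c' eE hc'.
    under eq_fun do under eq_fun do rewrite mulrACA -exprD.
    by apply: (zpolyZ _ (hpolyM hc hc')); rewrite addnACA dE eE.
  + move=> p q _ hp _ hq.
    under eq_fun do under eq_fun do rewrite mulrDr.
    exact: zpolyD.
- move=> p p' _ hp _ hp' hq.
  under eq_fun do under eq_fun do rewrite mulrDl.
  by apply: zpolyD; [exact: hp|exact: hp'].
Qed.

Lemma hpoly_zpoly m n d (q : ('I_m -> R) -> 'rV[R]_n.+1 -> R) :
  hpoly d q -> zpoly d q.
Proof.
have z0 e (c : ('I_m -> R) -> 'rV[R]_n -> R) : hpoly e c ->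
    zpoly e (fun t v => c t (behv v)).
  move=> hc; have := @zpolyZ _ _ e 0%N e c (add0n _) hc.
  by congr zpoly; apply/funext => t; apply/funext => y; rewrite expr0 mul1r.
elim => {d q}.
- by move=> d; exact: zpoly0.
- by move=> c; exact: (z0 _ _ (hpolyC _ _ c)).
- by move=> i; exact: (z0 _ _ (hpolyT _ i)).
- move=> i; case: (unliftP ord0 i) => [j|] ->.
    have := z0 _ _ (hpolyY m j).
    by congr zpoly; apply/funext => t; apply/funext => y; rewrite mxE.
  have := @zpolyZ m n 1%N 1%N 0%N _ (addn0 _) (hpolyC _ _ 1).
  by congr zpoly; apply/funext => t; apply/funext => y; rewrite expr1 mulr1.
- by move=> d p q _ hp _ hq; exact: zpolyD.
- by move=> d e p q _ hp _ hq; exact: zpolyM.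
Qed.

Lemma hpoly_behv m n d (c : ('I_m -> R) -> 'rV[R]_n -> R) : hpoly d c ->
  hpoly d (fun t (v : 'rV[R]_n.+1) => c t (behv v)).
Proof.
elim => {d c}.
- by move=> d; exact: hpoly0.
- by move=> c; exact: hpolyC.
- by move=> i; exact: hpolyT.
- move=> i; have := hpolyY m (lift ord0 i).
  by congr hpoly; apply/funext => t; apply/funext => y; rewrite mxE.
- by move=> d p q _ hp _ hq; exact: hpolyD.
- by move=> d e p q _ hp _ hq; exact: hpolyM.
Qed.

Lemma hpoly_antiderivative m n d (q : ('I_m -> R) -> 'rV[R]_n.+1 -> R) :
  hpoly d q -> exists2 Q : ('I_m -> R) -> 'rV[R]_n.+1 -> R, hpoly d.+1 Q & forall t y (z : R),
    is_derive z 1 (fun z => Q t (consv z y)) (q t (consv z y)).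
Proof.
move=> /hpoly_zpoly; elim => {q}.
- by exists (fun _ _ => 0); [exact: hpoly0|move=> t y z; exact: is_derive_cst].
- move=> k e c kd hc.
  exists (fun t (v : 'rV[R]_n.+1) => k.+1%:R^-1 * (v 0 ord0 ^+ k.+1 * c t (behv v))).
    apply: hpolyZ; rewrite -kd -addSn.
    apply: hpolyM (hpoly_behv hc).
    by have := hpolyX k.+1 (hpolyY m (@ord0 n)); rewrite muln1.
  move=> t y z.
  have -> : (fun z => k.+1%:R^-1 * (consv z y 0 ord0 ^+ k.+1 * c t (behv (consv z y)))) =
    (k.+1%:R^-1 * c t y) \*: (@GRing.exp R ^~ k.+1).
    apply/funext => z' /=; rewrite consv0 consvK; rewrite /GRing.scale /=; ring.
  rewrite consv0 consvK.
  have -> : @GRing.exp R ^~ k.+1 = (id : R -> R) ^+ k.+1.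
    by apply/funext => x; rewrite exprfctE.
  apply: (is_derive_eq (is_deriveZ _ (is_deriveX k.+1 (is_derive_id z 1)))).
  rewrite /GRing.scale /= mulr1.
  have k0 : k.+1%:R != 0 :> R by rewrite pnatr_eq0.
  by rewrite mulrACA mulVf// mul1r mulrC.
- move=> p q _ [P hP dP] _ [Q hQ dQ].
  exists (fun t (v : 'rV[R]_n.+1) => P t v + Q t v); first exact: hpolyD.
  by move=> t y z; exact: (is_deriveD (dP t y z) (dQ t y z)).
Qed.

Lemma hpoly_continuous0 m n d (q : ('I_m -> R) -> 'rV[R]_n.+1 -> R) t y :
  hpoly d q -> continuous (fun z => q t (consv z y)).
Proof.
elim => {d q}.
- by move=> d; exact: cst_continuous.
- by move=> c; exact: cst_continuous.
- by move=> i; exact: cst_continuous.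
- move=> i; case: (unliftP ord0 i) => [j|] -> z.
    under eq_fun do rewrite consvS; exact: cst_continuous.
  by under eq_fun do rewrite consv0.
- move=> d p q _ hp _ hq z; apply: continuousD; [exact: hp|exact: hq].
- move=> d e p q _ hp _ hq z; apply: continuousM; [exact: hp|exact: hq].
Qed.

Lemma hpoly_FTC m n d (q : ('I_m -> R) -> 'rV[R]_n.+1 -> R) :
  hpoly d q -> exists2 Q : ('I_m -> R) -> 'rV[R]_n.+1 -> R, hpoly d.+1 Q & forall t y a b, a <= b ->
    (\int[@lebesgue_measure R]_(z in `[a, b]) (q t (consv z y))%:E =
     (Q t (consv b y) - Q t (consv a y))%:E)%E.
Proof.
move=> hq; have [Q hQ dQ] := hpoly_antiderivative hq.
exists Q => // t y a b; rewrite le_eqVlt => /predU1P[->|ab].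
  by rewrite subrr set_itv1 integral_set1.
rewrite EFinB; apply: (@continuous_FTC2 _ _ (fun z => Q t (consv z y))) => //.
- by apply: continuous_subspaceT; exact: (hpoly_continuous0 hq).
- split.
  + by move=> z _; have [] := dQ t y z.
  + by apply: cvg_at_right_filter; exact: (hpoly_continuous0 hQ).
  + by apply: cvg_at_left_filter; exact: (hpoly_continuous0 hQ).
- by move=> z _; rewrite derive1E; have [_ ->] := dQ t y z.
Qed.

End HomogeneousPolynomials.

(** * Minkowski combinations of polytopes *)

Section ConvexSets.
Variable R : realType.

Lemma continuous_bigsum (T : topologicalType) (V : normedModType R)
    (I : Type) (r : seq I) (f : I -> T -> V) :
  (forall i, continuous (f i)) -> continuous (fun x => \sum_(i <- r) f i x).
Proof.
move=> cf; elim: r => [|i r IH].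
  by under eq_fun do rewrite big_nil; exact: cst_continuous.
under eq_fun do rewrite big_cons.
by move=> x; apply: continuousD; [exact: cf|exact: IH].
Qed.

Lemma convex_sum n (A : set 'rV[R]_n) (I : eqType) (r : seq I) (w : I -> R) (p : I -> 'rV[R]_n) :
  convex A -> (forall i, i \in r -> 0 <= w i) -> \sum_(i <- r) w i = 1 ->
  (forall i, i \in r -> A (p i)) -> A (\sum_(i <- r) w i *: p i).
Proof.
move=> cA w0 w1 Ap.
(* Generalised to an arbitrary positive total weight, since the tail of a convex combination is no
   longer normalised. *)
suff H : forall s, s = \sum_(i <- r) w i -> 0 < s -> A (s^-1 *: \sum_(i <- r) w i *: p i).
  by have := H 1 (esym w1) ltr01; rewrite invr1 scale1r.
move=> {w1}; elim: r w0 Ap => [|i r IH] w0 Ap s sE s0'.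
  by move: s0'; rewrite sE big_nil ltxx.
rewrite !big_cons in sE *.
have wi : 0 <= w i by rewrite w0 ?mem_head.
have Ai : A (p i) by apply: Ap; rewrite mem_head.
have w0r j : j \in r -> 0 <= w j by move=> jr; rewrite w0// inE jr orbT.
have : 0 <= \sum_(j <- r) w j by rewrite big_seq sumr_ge0.
rewrite le_eqVlt => /predU1P[r0|r0].
  have wr0 j : j \in r -> w j = 0.
    move=> jr; apply/eqP; rewrite eq_le w0r// andbT r0 (big_rem j)//= lerDl.
    by rewrite big_seq sumr_ge0// => k /mem_rem; exact: w0r.
  have -> : \sum_(j <- r) w j *: p j = 0.
    by rewrite big_seq big1 // => j jr; rewrite wr0// scale0r.
  rewrite -r0 addr0 in sE.
  by rewrite addr0 scalerA sE mulVf ?scale1r// -sE gt_eqF.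
set T := \sum_(j <- r) w j in sE r0 *.
have /IH := erefl T => /(_ w0r) /(_ _ r0) AT.
have {}AT : A (T^-1 *: \sum_(j <- r) w j *: p j).
  by apply: AT => j jr; apply: Ap; rewrite inE jr orbT.
have ws1 : w i / s <= 1 by rewrite ler_pdivrMr// mul1r sE lerDl ltW.
have := cA _ _ (w i / s) Ai AT (divr_ge0 wi (ltW s0')) ws1.
rewrite (_ : 1 - w i / s = T / s); last first.
  rewrite -(divff (lt0r_neq0 s0')) -mulrBl; congr (_ / _).
  by rewrite sE addrAC subrr add0r.
by rewrite scalerA mulrAC divff ?gt_eqF// mul1r scalerDr scalerA [s^-1 * _]mulrC.
Qed.

Lemma mink_combS n m (t : 'I_m.+1 -> R) (K : 'I_m.+1 -> set 'rV[R]_n) :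
  mink_comb t K = (fun p => t ord0 *: p.1 + p.2) @`
    (K ord0 `*` mink_comb (fun i => t (lift ord0 i)) (fun i => K (lift ord0 i))).
Proof.
apply/seteqP; split => x.
  move=> [y [Ky ->]]; exists (y ord0, \sum_i t (lift ord0 i) *: y (lift ord0 i)).
    by split => //; exists (fun i => y (lift ord0 i)).
  by rewrite big_ord_recl.
move=> [[a b] [/= Ka [y [Ky ->]]] <-].
exists (fun i => oapp y a (unlift ord0 i)); split => [i|].
  by case: (unliftP ord0 i) => [j|] -> /=.
rewrite big_ord_recl unlift_none /=; congr (_ + _).
by apply: eq_bigr => i _; rewrite liftK.
Qed.

Lemma mink_comb_compact n m (t : 'I_m -> R) (K : 'I_m -> set 'rV[R]_n) :
  (forall i, compact (K i)) -> compact (mink_comb t K).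
Proof.
elim: m t K => [|m IH] t K cK.
  suff -> : mink_comb t K = [set 0] by exact: compact_set1.
  apply/seteqP; split => x; first by move=> [y [_ ->]]; rewrite big_ord0.
  by move=> ->; exists (fun _ => 0); split => [[]//|]; rewrite big_ord0.
rewrite mink_combS; apply: continuous_compact.
  apply: continuous_subspaceT => p.
  apply: (@continuousD _ _ _ (fun p => t ord0 *: p.1) snd).
    by apply: cvgZl_tmp; exact: cvg_fst.
  exact: cvg_snd.
by apply: compact_setX => //; exact: IH.
Qed.

Lemma mink_comb_convex n m (t : 'I_m -> R) (K : 'I_m -> set 'rV[R]_n) :
  (forall i, convex (K i)) -> convex (mink_comb t K).
Proof.
move=> cK x y s [a [Ka ->]] [b [Kb ->]] s0 s1.
exists (fun i => s *: a i + (1 - s) *: b i); split => [i|]; first exact: cK.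
rewrite !scaler_sumr -big_split /=; apply: eq_bigr => i _.
by rewrite scalerDr !scalerA ![t i * _]mulrC.
Qed.

Lemma mink_comb_neq0 n m (t : 'I_m -> R) (K : 'I_m -> set 'rV[R]_n) :
  (forall i, K i !=set0) -> mink_comb t K !=set0.
Proof.
move=> /boolp.choice[y Ky].
by exists (\sum_i t i *: y i), y.
Qed.

Definition simplex_weights N : set ('I_N -> R) :=
  [set w | (forall j, 0 <= w j) /\ \sum_j w j = 1].

(** Indexed by ['I_N], repetitions allowed, so that all summands of a Minkowski combination can
    share one index type. *)
Definition conv_pts n N (P : 'I_N -> 'rV[R]_n) : set 'rV[R]_n :=
  [set \sum_j w j *: P j | w in @simplex_weights N].

Lemma conv_pts_mem n N (P : 'I_N -> 'rV[R]_n) j : conv_pts P (P j).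
Proof.
exists (fun k => (k == j)%:R); last first.
  rewrite (bigD1 j)//= eqxx scale1r big1 ?addr0// => k /negbTE ->.
  by rewrite scale0r.
split=> [k|]; first by rewrite ler0n.
by rewrite (bigD1 j)//= eqxx big1 ?addr0// => k /negbTE ->.
Qed.

Lemma conv_pts_convex n N (P : 'I_N -> 'rV[R]_n) : convex (conv_pts P).
Proof.
move=> _ _ t [u [u0 u1] <-] [v [v0 v1] <-] t0 t1.
exists (fun j => t * u j + (1 - t) * v j).
  split => [j|]; first by rewrite addr_ge0 ?mulr_ge0// subr_ge0.
  by rewrite big_split /= -!mulr_sumr u1 v1; ring.
rewrite !scaler_sumr -big_split /=; apply: eq_bigr => j _.
by rewrite scalerDl !scalerA.
Qed.

Lemma conv_pts_min n N (P : 'I_N -> 'rV[R]_n) (A : set 'rV[R]_n) :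
  convex A -> (forall j, A (P j)) -> conv_pts P `<=` A.
Proof. by move=> cA AP _ [w [w0 w1] <-]; exact: convex_sum. Qed.

Lemma conv_pts_compact n N (P : 'I_N -> 'rV[R]_n) : compact (conv_pts P).
Proof.
have -> : conv_pts P = (fun w : 'rV[R]_N => \sum_j w 0 j *: P j) @`
    ([set w : 'rV[R]_N | forall j, `[0, 1]%classic (w 0 j)] `&`
     (fun w : 'rV[R]_N => \sum_j w 0 j) @^-1` [set 1]).
  apply/seteqP; split => x.
    move=> [w [w0 w1] <-]; exists (\row_j w j); last first.
      by apply: eq_bigr => j _; rewrite mxE.
    split => [j|] /=; last first.
      by rewrite -w1; apply: eq_bigr => j _; rewrite mxE.
    rewrite mxE in_itv /= w0 -w1 (bigD1 j)//= lerDl.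
    by apply: sumr_ge0 => k _; exact: w0.
  move=> [w [w01 w1] <-]; exists (fun j => w 0 j) => //; split => // j.
  by have := w01 j; rewrite /= in_itv /= => /andP[].
apply: continuous_compact.
  apply: continuous_subspaceT; apply: continuous_bigsum => j w.
  apply: continuousZr_tmp; exact: (@coord_continuous R 1 N 0 j w).
apply: compact_closedI.
  by apply: (@rV_compact R N (fun=> `[0, 1]%classic)) => j; exact: segment_compact.
apply: preimage_closed; last exact: closed_eq.
by move=> w _; apply: continuous_bigsum => j; exact: (@coord_continuous R 1 N 0 j).
Qed.

Definition mixsum n m N (S : 'I_m -> 'I_N -> 'rV[R]_n) (t : 'I_m -> R) :=
  mink_comb t (fun i => conv_pts (S i)).

Lemma mixsum_compact n m N (S : 'I_m -> 'I_N -> 'rV[R]_n) t : compact (mixsum S t).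
Proof. by apply: mink_comb_compact => i; exact: conv_pts_compact. Qed.

Lemma mixsum_convex n m N (S : 'I_m -> 'I_N -> 'rV[R]_n) t : convex (mixsum S t).
Proof. by apply: mink_comb_convex => i; exact: conv_pts_convex. Qed.

Lemma mixsum_neq0 n m N (S : 'I_m -> 'I_N.+1 -> 'rV[R]_n) t : mixsum S t !=set0.
Proof. by apply: mink_comb_neq0 => i; exists (S i ord0); exact: conv_pts_mem. Qed.

End ConvexSets.

(** * Upper boundary of a Minkowski combination of polytopes *)

Section UpperBoundary.
Variable R : realType.

Definition dotv n (a y : 'rV[R]_n) : R := \sum_i a 0 i * y 0 i.

Lemma dotvDr n (a x y : 'rV[R]_n) : dotv a (x + y) = dotv a x + dotv a y.
Proof. by rewrite -big_split; apply: eq_bigr => i _; rewrite mxE mulrDr. Qed.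

Lemma dotvZr n (a : 'rV[R]_n) k y : dotv a (k *: y) = k * dotv a y.
Proof. by rewrite mulr_sumr; apply: eq_bigr => i _; rewrite mxE mulrCA. Qed.

Lemma dotvBr n (a x y : 'rV[R]_n) : dotv a (x - y) = dotv a x - dotv a y.
Proof. by rewrite -scaleN1r dotvDr dotvZr mulN1r. Qed.

Lemma dotvBl n (a b y : 'rV[R]_n) : dotv (a - b) y = dotv a y - dotv b y.
Proof. by rewrite -sumrB; apply: eq_bigr => i _; rewrite !mxE mulrBl. Qed.

Lemma dotvZl n k (a y : 'rV[R]_n) : dotv (k *: a) y = k * dotv a y.
Proof. by rewrite mulr_sumr; apply: eq_bigr => i _; rewrite mxE mulrA. Qed.

Lemma dotv_sumr n (a : 'rV[R]_n) (I : Type) (r : seq I) (f : I -> 'rV[R]_n) :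
  dotv a (\sum_(i <- r) f i) = \sum_(i <- r) dotv a (f i).
Proof.
elim: r => [|i r IH]; last by rewrite !big_cons dotvDr IH.
by rewrite !big_nil /dotv big1// => i _; rewrite mxE mulr0.
Qed.

Lemma behvD n (x y : 'rV[R]_n.+1) : behv (x + y) = behv x + behv y.
Proof. by apply/rowP => i; rewrite !mxE. Qed.

Lemma behvZ n k (x : 'rV[R]_n.+1) : behv (k *: x) = k *: behv x.
Proof. by apply/rowP => i; rewrite !mxE. Qed.

Lemma behv_sum n (I : Type) (r : seq I) (f : I -> 'rV[R]_n.+1) :
  behv (\sum_(i <- r) f i) = \sum_(i <- r) behv (f i).
Proof.
elim: r => [|i r IH]; last by rewrite !big_cons behvD IH.
by rewrite !big_nil; apply/rowP => i; rewrite !mxE.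
Qed.

Lemma continuous_sqr (T : topologicalType) (f : T -> R) :
  continuous f -> continuous (fun x => f x ^+ 2).
Proof.
by move=> cf x; under eq_fun do rewrite expr2; apply: continuousM; exact: cf.
Qed.

(** First-order condition at the endpoint 0 of a segment: 2A is the right derivative there of a
    quadratic with minimum at 0. *)
Lemma ge0_slope (A B : R) :
  (forall s, 0 <= s -> s <= 1 -> 0 <= s * (2 * A + s * B)) -> 0 <= A.
Proof.
move=> h; have [//|A0] := leP 0 A.
have B1 : 0 < `|B| + 1 - A by rewrite subr_gt0 (lt_le_trans A0)// addr_ge0.
(* Small enough that s B <= -A, which makes 2A + s B at most A, hence negative. *)
pose s := - A / (`|B| + 1 - A).
have s0 : 0 < s by rewrite divr_gt0// oppr_gt0.
have s1 : s <= 1 by rewrite ler_pdivrMr// mul1r lerDr addr_ge0.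
have := h s (ltW s0) s1; rewrite pmulr_rge0// => h'.
have : s * B <= - A.
  rewrite /s mulrAC ler_pdivrMr// ler_pM2l ?oppr_gt0//.
  rewrite (le_trans (ler_norm B))// -addrA lerDl subr_ge0.
  by rewrite (le_trans (ltW A0)).
by lra.
Qed.

(* An affine function of slope [a] dominates the polytope exactly when its
   intercept is at least the sum of the [t i * height a i]. *)
Section Slopes.
Variables (n m N : nat) (S : 'I_m -> 'I_N.+1 -> 'rV[R]_n.+1).

Definition intercept (a : 'rV[R]_n) (x : 'rV[R]_n.+1) : R :=
  x 0 ord0 - dotv a (behv x).

Definition top_index a i : 'I_N.+1 :=
  [arg max_(j > ord0) intercept a (S i j)]%O.

(** The support function of the i-th polytope in the direction (1, -a). *)
Definition height a i : R := intercept a (S i (top_index a i)).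

Definition tight a : {set 'I_m * 'I_N.+1} :=
  [set ij | intercept a (S ij.1 ij.2) == height a ij.1].

(* A chosen slope whose tight index set is [F] (junk when there is none, see
   [is_face]). *)
Definition slope (F : {set 'I_m * 'I_N.+1}) : 'rV[R]_n :=
  xget 0 [set a | tight a = F].

Definition is_face (F : {set 'I_m * 'I_N.+1}) := tight (slope F) == F.

(** Points outside [F] are replaced by a tight one instead of being dropped, so that a face is again
    a family over ['I_N.+1] and the induction on the dimension applies to it directly. *)
Definition face_index (F : {set 'I_m * 'I_N.+1}) i j :=
  if (i, j) \in F then j else top_index (slope F) i.

Definition face_pts F i j : 'rV[R]_n := behv (S i (face_index F i j)).

(** The shadow of an upper face; a face of a Minkowski sum is the sum of the faces with the same
    normal. *)
Definition cell F (t : 'I_m -> R) : set 'rV[R]_n := mixsum (face_pts F) t.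

Definition face_height F (t : 'I_m -> R) (y : 'rV[R]_n) : R :=
  dotv (slope F) y + \sum_i t i * height (slope F) i.

Lemma tight_face a : is_face (tight a).
Proof.
rewrite /is_face; apply/eqP.
exact: (@xgetPex _ 0 [set b | tight b = tight a] (ex_intro _ a erefl)).
Qed.

Lemma interceptD a x y : intercept a (x + y) = intercept a x + intercept a y.
Proof. by rewrite /intercept behvD dotvDr !mxE; ring. Qed.

Lemma interceptZ a k x : intercept a (k *: x) = k * intercept a x.
Proof. by rewrite /intercept behvZ dotvZr !mxE; ring. Qed.

Lemma intercept_sum a (I : Type) (r : seq I) (f : I -> 'rV[R]_n.+1) :
  intercept a (\sum_(i <- r) f i) = \sum_(i <- r) intercept a (f i).
Proof.
elim: r => [|i r IH]; last by rewrite !big_cons interceptD IH.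
rewrite !big_nil /intercept /dotv !mxE big1 ?subrr// => i _.
by rewrite !mxE mulr0.
Qed.

Lemma intercept_consv a z y : intercept a (consv z y) = z - dotv a y.
Proof. by rewrite /intercept consv0 consvK. Qed.

Lemma intercept_le a i j : intercept a (S i j) <= height a i.
Proof. by rewrite /height /top_index; case: arg_maxP => // k _ /(_ j); exact. Qed.

Lemma intercept_conv_le a i x : conv_pts (S i) x -> intercept a x <= height a i.
Proof.
move=> [w [w0 w1] <-]; rewrite intercept_sum -[height a i]mul1r -w1 mulr_suml.
by apply: ler_sum => j _; rewrite interceptZ ler_wpM2l// intercept_le.
Qed.

Lemma intercept_mixsum_le a t x : (forall i, 0 <= t i) -> mixsum S t x ->
  intercept a x <= \sum_i t i * height a i.
Proof.
move=> t0 [y [Sy ->]]; rewrite intercept_sum; apply: ler_sum => i _.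
by rewrite interceptZ ler_wpM2l// intercept_conv_le.
Qed.

Lemma intercept_face F i j : is_face F ->
  intercept (slope F) (S i (face_index F i j)) = height (slope F) i.
Proof.
move=> /eqP FE; rewrite /face_index; case: ifPn => // ijF.
by move: ijF; rewrite -{1}FE inE => /eqP.
Qed.

(** Every summand is lifted with the weights that represent its projection. All points used attain
    the height of their polytope, so the intercepts add up to that of the supporting affine
    function. *)
Lemma cell_lift F t y : is_face F -> cell F t y ->
  mixsum S t (consv (face_height F t y) y).
Proof.
move=> FF [c [cF yE]].
have H i : exists x, conv_pts (S i) x /\ behv x = c i /\
    intercept (slope F) x = height (slope F) i.
  have [w [w0 w1] cE] := cF i.
  exists (\sum_j w j *: S i (face_index F i j)); split; last split.
  - apply: convex_sum => //; first exact: conv_pts_convex.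
    by move=> j _; exact: conv_pts_mem.
  - by rewrite behv_sum -cE; apply: eq_bigr => j _; rewrite behvZ.
  rewrite intercept_sum -[RHS]mul1r -w1 mulr_suml; apply: eq_bigr => j _.
  by rewrite interceptZ intercept_face.
have [x xP] := boolp.choice H; exists x; split => [i|]; first by have [] := xP i.
set X := \sum_i _.
have <- : behv X = y.
  by rewrite behv_sum yE; apply: eq_bigr => i _; rewrite behvZ; have [_ [->]] := xP i.
have XE : intercept (slope F) X = \sum_i t i * height (slope F) i.
  rewrite intercept_sum; apply: eq_bigr => i _.
  by rewrite interceptZ; have [_ [_ ->]] := xP i.
by rewrite -[RHS]consv_behv /face_height -XE /intercept addrC subrK.
Qed.

(** Equality in a sum of inequalities forces equality in each term. This is used twice: over the
    summands i, and over the convex weights within one polytope. *)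
Lemma cell_tight a t x : (forall i, 0 <= t i) -> mixsum S t x ->
  intercept a x = \sum_i t i * height a i -> cell (tight a) t (behv x).
Proof.
move=> t0 [y [Sy ->]]; rewrite intercept_sum => /eqP.
under eq_bigr do rewrite interceptZ.
rewrite eq_sym -subr_eq0 -sumrB psumr_eq0 => [|i _]; last first.
  by rewrite subr_ge0 ler_wpM2l// intercept_conv_le.
move=> /allP H.
(* A summand with coefficient 0 is not constrained by tightness, so any point of the face replaces
   it. *)
exists (fun i => if t i == 0 then face_pts (tight a) i ord0 else behv (y i)).
split => [i|]; last first.
  rewrite behv_sum; apply: eq_bigr => i _; rewrite behvZ.
  by case: eqP => // ->; rewrite !scale0r.
case: ifPn => ti0; first exact: conv_pts_mem.
have := H i (mem_index_enum i); rewrite /= -mulrBr mulf_eq0 (negbTE ti0) /=.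
have [w [w0 w1] <-] := Sy i.
rewrite intercept_sum -[height a i]mul1r -w1 mulr_suml -sumrB.
under eq_bigr do rewrite interceptZ -mulrBr.
rewrite psumr_eq0 => [|j _]; last by rewrite mulr_ge0// subr_ge0 intercept_le.
move=> /allP wH; exists w; first by [].
rewrite behv_sum; apply: eq_bigr => j _; rewrite behvZ.
have := wH j (mem_index_enum j); rewrite /= mulf_eq0 => /orP[/eqP ->|].
  by rewrite !scale0r.
rewrite subr_eq0 eq_sym => jt; congr (_ *: _).
by rewrite /face_pts /face_index inE /= jt.
Qed.

Lemma cell_compact F t : compact (cell F t).
Proof. exact: mixsum_compact. Qed.

Lemma sqsum_ge k (b : 'rV[R]_k) i : b 0 i ^+ 2 <= \sum_i b 0 i ^+ 2.
Proof. by rewrite (bigD1 i)//= lerDl sumr_ge0// => j _; exact: sqr_ge0. Qed.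

(* Penalising horizontal displacement from [y] ever more strongly produces
   supporting hyperplanes at points of the upper boundary close to [y]. *)
Lemma cell_approx t y z (r : R) : (forall i, 0 <= t i) -> 0 < r ->
  mixsum S t (consv z y) ->
  exists F y', [/\ is_face F, cell F t y' & `|y' - y| <= r].
Proof.
move=> t0 r0 Py.
have cP : compact (mixsum S t) by exact: mixsum_compact.
have [M M0 MP] : exists2 M : R, 0 < M & forall x, mixsum S t x -> `|x| <= M.
  have [M [Mr MP]] := compact_bounded cP.
  exists (`|M| + 1); first by rewrite ltr_wpDl.
  by move=> x Px; apply: MP => //; rewrite (le_lt_trans (ler_norm M))// ltrDl.
(* [Z] exceeds every first coordinate on the polytope, so the squared distance to level [Z]
   decreases upwards and minimising it pushes towards the upper boundary. *)
pose Z := M + 1.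
have xZ x : mixsum S t x -> 0 < Z - x 0 ord0.
  move=> /MP xM; rewrite subr_gt0 /Z.
  apply: (@le_lt_trans _ _ M); last by rewrite ltrDl.
  by rewrite (le_trans _ xM)// (le_trans (ler_norm _))// rv_norm_coord.
(* Chosen so that a minimiser, being no worse than the point above [y], has squared horizontal
   displacement at most r^2; the 1 keeps [K] positive. *)
pose K := ((Z - z) ^+ 2 + 1) / r ^+ 2.
have K0 : 0 < K by rewrite divr_gt0 ?exprn_gt0// ltr_wpDl ?sqr_ge0.
pose psi (x : 'rV[R]_n.+1) := K * \sum_i (x 0 (lift ord0 i) - y 0 i) ^+ 2 + (Z - x 0 ord0) ^+ 2.
have cpsi : continuous psi.
  move=> x; apply: (@continuousD _ _ _ (fun x => K * _) (fun x => (Z - _) ^+ 2)).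
    apply: (@continuousM _ _ (fun=> K)); first exact: cst_continuous.
    apply: (@continuous_bigsum R _ R^o) => i; apply: continuous_sqr => u.
    by apply: continuousB; [exact: coord_continuous|exact: cst_continuous].
  apply: (@continuous_sqr _ (fun x : 'rV[R]_n.+1 => Z - x 0 ord0)) => u.
  by apply: (@continuousB R R^o _ (fun=> Z) (fun u : 'rV[R]_n.+1 => u 0 ord0));
    [exact: cst_continuous|exact: coord_continuous].
have [p] := compact_EVT_min (mixsum_neq0 S t) cP (continuous_subspaceT cpsi).
rewrite inE => Pp pmin.
pose b := behv p - y.
(* The gradient of [psi] at [p] is a negative multiple of (1, -a), so minimality of [psi] makes [p]
   a maximiser of [intercept a]. *)
pose a := (K / (Z - p 0 ord0)) *: b.
have Zp := xZ p Pp.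
have var x : mixsum S t x -> intercept a x <= intercept a p.
  move=> Px; pose d := x - p.
  pose A := K * dotv b (behv d) - (Z - p 0 ord0) * d 0 ord0.
  pose B := K * \sum_i d 0 (lift ord0 i) ^+ 2 + d 0 ord0 ^+ 2.
  have A0 : 0 <= A.
    apply: (@ge0_slope A B) => s s0 s1.
    have Ps : mixsum S t (s *: x + (1 - s) *: p) by exact: mixsum_convex.
    have -> : s * (2 * A + s * B) = psi (s *: x + (1 - s) *: p) - psi p.
      rewrite /psi; set X := \sum_i _; set Y := \sum_i (p _ _ - _) ^+ 2.
      have -> : X = Y + 2 * s * dotv b (behv d) + s ^+ 2 * \sum_i d 0 (lift ord0 i) ^+ 2.
        rewrite /X /Y /dotv !mulr_sumr -!big_split /=; apply: eq_bigr => i _.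
        rewrite /d /b !mxE; ring.
      rewrite /A /B /d !mxE; ring.
    by rewrite subr_ge0 pmin ?inE.
  rewrite /intercept /a !dotvZl -subr_ge0.
  have -> : p 0 ord0 - K / (Z - p 0 ord0) * dotv b (behv p) -
    (x 0 ord0 - K / (Z - p 0 ord0) * dotv b (behv x)) = A / (Z - p 0 ord0).
    have dE : behv d = behv x - behv p by apply/rowP => i; rewrite !mxE.
    have d0E : d 0 ord0 = x 0 ord0 - p 0 ord0 by rewrite !mxE.
    rewrite /A dE d0E dotvBr; field.
    by rewrite gt_eqF.
  by rewrite divr_ge0// ltW.
exists (tight a), (behv p); split; first exact: tight_face.
  apply: cell_tight => //; apply/eqP; rewrite eq_le intercept_mixsum_le//=.
  (* This combination of top points attains the upper bound for the intercept, hence so does the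
     maximiser [p]. *)
  have Pt : mixsum S t (\sum_i t i *: S i (top_index a i)).
    by exists (fun i => S i (top_index a i)); split => // i; exact: conv_pts_mem.
  apply: le_trans (var _ Pt); rewrite intercept_sum.
  by apply: ler_sum => i _; rewrite interceptZ.
apply/rv_normP => [|i]; first exact: ltW.
rewrite -(ler_pXn2r (_ : 0 < 2)%N) ?nnegrE ?(ltW r0)// real_normK ?num_real//.
apply: le_trans (sqsum_ge b i) _.
have : psi p <= psi (consv z y) by apply: pmin; rewrite inE.
rewrite /psi consv0 [X in _ <= K * X + _]big1 => [|j _]; last first.
  by rewrite consvS subrr expr0n.
rewrite mulr0 add0r => H.
have : K * \sum_i b 0 i ^+ 2 <= (Z - z) ^+ 2 + 1.
  apply: (@le_trans _ _ ((Z - z) ^+ 2)); last by rewrite lerDl.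
  apply: le_trans H; rewrite -[leLHS]addr0 lerD ?sqr_ge0//.
  by rewrite ler_pM2l//; apply: ler_sum => j _; rewrite !mxE.
rewrite -ler_pdivlMl// invfM invrK mulrAC mulVf ?mul1r// gt_eqF//.
by rewrite ltr_wpDl ?sqr_ge0.
Qed.

End Slopes.
End UpperBoundary.

(** * Integrals of polynomials over Minkowski combinations of polytopes *)

Section IntegralPolytopes.
Variable R : realType.

Lemma mu_compact_fin n (A : set 'rV[R]_n) : compact A ->
  (mu R n (@emb R n @^-1` A) < +oo)%E.
Proof.
move=> cA; have [M [Mr MA]] := compact_bounded cA.
pose r := `|M| + 1.
have r0 : 0 <= r by rewrite addr_ge0.
apply: (@le_lt_trans _ _ (mu R n (@emb R n @^-1` box (const_mx (- r)) (const_mx r)))).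
  apply: le_measure; rewrite ?inE; [exact: measurable_compact|exact: measurable_box|].
  move=> w /= Aw i; rewrite !mxE -ler_norml.
  apply: le_trans (rv_norm_coord _ _) _; apply: MA => //.
  by rewrite (le_lt_trans (ler_norm M))// ltrDl.
rewrite mu_box ?ltry// => i; rewrite !mxE.
by rewrite (le_trans _ r0)// oppr_le0.
Qed.

Lemma integral_indicE d (T : measurableType d) (nu : {measure set T -> \bar R})
    (D : set T) (f : T -> R) :
  (\int[nu]_(x in D) (f x)%:E = \int[nu]_x (f x * \1_D x)%:E)%E.
Proof.
rewrite integral_mkcond; apply: eq_integral => x _.
by rewrite patchE indicE; case: ifPn => _; rewrite ?mulr1 ?mulr0.
Qed.

Lemma integrable_hpoly m n d (q : ('I_m -> R) -> 'rV[R]_n -> R) t A :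
  hpoly d q -> compact A ->
  (mu R n).-integrable setT
    (fun w => (q t (emb w) * \1_(@emb R n @^-1` A) w)%:E).
Proof.
move=> hq cA.
have mA := measurable_compact cA.
have : (mu R n).-integrable (@emb R n @^-1` A) (EFin \o (fun w => q t (emb w))).
  apply: measurable_bounded_integrable => //.
  - exact: mu_compact_fin.
  - by apply: measurable_funTS; exact: measurable_hpoly hq.
  - have [M [Mr MA]] := compact_bounded cA.
    have [B HB] := hpoly_bounded t (`|M| + 1) hq.
    exists B; split; first exact: num_real.
    move=> x Bx w Aw; apply: le_trans (ltW Bx); apply: HB; apply: MA => //.
    by rewrite (le_lt_trans (ler_norm M))// ltrDl.
rewrite (integrable_mkcond _ mA); congr integrable; apply/funext => w.
by rewrite patchE indicE; case: ifPn => _ /=; rewrite ?mulr1 ?mulr0.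
Qed.

(** Mirroring the first coordinate turns the lower boundary into an upper one, so one analysis
    serves for both. *)
Definition reflv n (v : 'rV[R]_n.+1) := consv (- v 0 ord0) (behv v).

Lemma reflvD n (u v : 'rV[R]_n.+1) : reflv (u + v) = reflv u + reflv v.
Proof.
apply/rowP => i; rewrite [RHS]mxE; case: (unliftP ord0 i) => [j|] ->.
  by rewrite /reflv !consvS !mxE.
by rewrite /reflv !consv0 !mxE opprD.
Qed.

Lemma reflvZ n k (v : 'rV[R]_n.+1) : reflv (k *: v) = k *: reflv v.
Proof.
apply/rowP => i; rewrite [RHS]mxE; case: (unliftP ord0 i) => [j|] ->.
  by rewrite /reflv !consvS !mxE.
by rewrite /reflv !consv0 !mxE mulrN.
Qed.

Lemma reflv_sum n (I : Type) (r : seq I) (f : I -> 'rV[R]_n.+1) :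
  reflv (\sum_(i <- r) f i) = \sum_(i <- r) reflv (f i).
Proof.
elim: r => [|i r IH]; last by rewrite !big_cons reflvD IH.
by rewrite !big_nil -[0 in LHS](scale0r (0 : 'rV[R]_n.+1)) reflvZ scale0r.
Qed.

Lemma reflvK n (v : 'rV[R]_n.+1) : reflv (reflv v) = v.
Proof. by rewrite /reflv consv0 consvK opprK consv_behv. Qed.

Lemma reflv_consv n x (y : 'rV[R]_n) : reflv (consv x y) = consv (- x) y.
Proof. by rewrite /reflv consv0 consvK. Qed.

Lemma mixsum_reflv n m N (S : 'I_m -> 'I_N.+1 -> 'rV[R]_n.+1) t v :
  mixsum S t v -> mixsum (fun i j => reflv (S i j)) t (reflv v).
Proof.
move=> [y [Sy ->]]; exists (fun i => reflv (y i)); split => [i|]; last first.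
  by rewrite reflv_sum; apply: eq_bigr => i _; rewrite reflvZ.
have [w w1 <-] := Sy i; exists w => //.
by rewrite reflv_sum; apply: eq_bigr => j _; rewrite reflvZ.
Qed.

Lemma mixsum_reflvE n m N (S : 'I_m -> 'I_N.+1 -> 'rV[R]_n.+1) t v :
  mixsum (fun i j => reflv (S i j)) t v -> mixsum S t (reflv v).
Proof.
move=> /mixsum_reflv; congr mixsum.
by apply/funext => i; apply/funext => j; rewrite reflvK.
Qed.

Section Cells.
Variables (n m N : nat) (S : 'I_m -> 'I_N.+1 -> 'rV[R]_n.+1) (t : 'I_m -> R).
Hypothesis t0 : forall i, 0 <= t i.

(** The union of the cells is closed, being a finite union of compact sets, and [cell_approx] finds
    its points arbitrarily close to [y]. *)
Lemma cell_cover z y : mixsum S t (consv z y) ->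
  exists2 F, is_face S F & cell S F t y.
Proof.
move=> Py; pose U := \bigcup_(F in [set F | is_face S F]) cell S F t.
suff : U y by move=> [F FF yF]; exists F.
have cU : closed U.
  apply: closed_bigcup => [|F _]; first exact: finite_finset.
  by apply: compact_closed (@norm_hausdorff _ _) _; exact: cell_compact.
apply: cU => B /nbhs_ballP[r /= r0 rB].
have [F [y' [FF Fy' yy']]] := cell_approx t0 (divr_gt0 r0 (ltr0Sn _ 1)) Py.
exists y'; split; first by exists F.
apply: rB; rewrite -ball_normE /ball_ /= distrC.
by rewrite (le_lt_trans yy')// ltr_pdivrMr// ltr_pMr// ltr1n.
Qed.

Lemma cell_max F z y : is_face S F -> cell S F t y -> mixsum S t (consv z y) ->
  z <= face_height S F t y.
Proof.
move=> FF yF /(intercept_mixsum_le (slope S F) t0).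
by rewrite intercept_consv /face_height lerBlDl.
Qed.

Lemma face_height_eq F F' y : is_face S F -> is_face S F' ->
  cell S F t y -> cell S F' t y -> face_height S F t y = face_height S F' t y.
Proof.
move=> FF FF' yF yF'; apply/eqP; rewrite eq_le.
by apply/andP; split; [apply: (cell_max FF' yF')|apply: (cell_max FF yF)];
  exact: cell_lift.
Qed.

(** A face is determined by its slope, so distinct faces have distinct slopes and their affine
    heights agree only on a hyperplane. *)
Lemma ae_distinct_heights : {ae mu R n, forall w, forall F F',
  is_face S F -> is_face S F' -> F != F' ->
  face_height S F t (emb w) != face_height S F' t (emb w)}.
Proof.
apply: filter_forall => F; apply: filter_forall => F'.
have [/andP[FF /andP[FF' FF'N]]|H] := boolP [&& is_face S F, is_face S F' & F != F']; last first.
  by apply: aeW => w H1 H2 H3; move: H; rewrite H1 H2 H3.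
have sFF' : slope S F - slope S F' != 0.
  apply: contra FF'N; rewrite subr_eq0 => /eqP sE.
  by rewrite -(eqP FF) -(eqP FF') sE.
pose c := \sum_i t i * height S (slope S F') i - \sum_i t i * height S (slope S F) i.
exists [set w | \sum_i (slope S F - slope S F') 0 i * emb w 0 i = c]; split.
- exact: measurable_hyperplane.
- exact: mu_hyperplane.
move=> w /= /not_implyP[_] /not_implyP[_] /not_implyP[_] /negP; rewrite negbK => /eqP.
rewrite -/(dotv _ _) dotvBl /face_height /c => E.
by apply/eqP; rewrite subr_eq addrAC -subr_eq opprK addrC -E addrC.
Qed.

End Cells.

Section HeightIntegration.
Variables (n m N d : nat) (S : 'I_m -> 'I_N.+1 -> 'rV[R]_n.+1).
Variables (q Q : ('I_m -> R) -> 'rV[R]_n.+1 -> R).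
Hypotheses (hq : hpoly d q) (hQ : hpoly d.+1 Q).
Hypothesis FTC : forall t y a b, a <= b ->
    (\int[@lebesgue_measure R]_(z in `[a, b]) (q t (consv z y))%:E =
     (Q t (consv b y) - Q t (consv a y))%:E)%E.

Let S' i j := reflv (S i j).

Let top_term F (t : 'I_m -> R) (y : 'rV[R]_n) := Q t (consv (face_height S F t y) y).
Let bot_term F (t : 'I_m -> R) (y : 'rV[R]_n) := Q t (consv (- face_height S' F t y) y).

Lemma hpoly_face_height (S0 : 'I_m -> 'I_N.+1 -> 'rV[R]_n.+1) F :
  hpoly 1 (face_height S0 F).
Proof.
have h1 : hpoly 1 (fun (_ : 'I_m -> R) y => dotv (slope S0 F) y).
  apply: (@hpoly_sum _ m n 1 _ _ _ (fun i _ y => slope S0 F 0 i * y 0 i)) => i _.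
  exact: (hpolyZ (slope S0 F 0 i) (hpolyY R m i)).
have h2 : hpoly 1 (fun t (_ : 'rV[R]_n) => \sum_i t i * height S0 (slope S0 F) i).
  apply: (@hpoly_sum _ m n 1 _ _ _ (fun i t _ => t i * height S0 (slope S0 F) i)) => i _.
  exact: (hpolyM (hpolyT R n i) (hpolyC m n (height S0 (slope S0 F) i))).
exact: hpolyD h1 h2.
Qed.

Lemma hpoly_top F : hpoly d.+1 (top_term F).
Proof. exact: hpoly_subst hQ (hpoly_face_height _ _). Qed.

Lemma hpoly_bot F : hpoly d.+1 (bot_term F).
Proof. exact: hpoly_subst hQ (hpolyN (hpoly_face_height _ _)). Qed.

(** Two upper cells containing y have the same height there, so distinct heights leave one upper and
    one lower cell. The sums reduce to one term each, and the section is the interval between the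
    two heights. *)
Lemma inner_integral t (w : sp R n) : (forall i, 0 <= t i) ->
  (forall F F', is_face S F -> is_face S F' -> F != F' ->
    face_height S F t (emb w) != face_height S F' t (emb w)) ->
  (forall F F', is_face S' F -> is_face S' F' -> F != F' ->
    face_height S' F t (emb w) != face_height S' F' t (emb w)) ->
  (\int[@lebesgue_measure R]_x (q t (@emb R n.+1 (x, w)) *
      \1_(@emb R n.+1 @^-1` mixsum S t) (x, w))%:E =
  (\sum_(F | is_face S F) top_term F t (emb w) * \1_(@emb R n @^-1` cell S F t) w -
   \sum_(F | is_face S' F) bot_term F t (emb w) * \1_(@emb R n @^-1` cell S' F t) w)%:E)%E.
Proof.
move=> t0 hS hS'; set y := emb w.
have [[z Pz]|noz] := pselect (exists z, mixsum S t (consv z y)); last first.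
  rewrite integral0_eq => [|x _]; last first.
    rewrite indicE memNset ?mulr0// => Px; apply: noz; exists x; exact: Px.
  rewrite !big1 ?subrr// => F FF; rewrite indicE memNset ?mulr0// => yF; apply: noz.
    have /mixsum_reflvE := cell_lift FF yF; rewrite reflv_consv => H.
    by exists (- face_height S' F t y).
  by exists (face_height S F t y); exact: cell_lift.
have [F0 FF0 yF0] := cell_cover t0 Pz.
have P'z : mixsum S' t (consv (- z) y) by rewrite -reflv_consv; exact: mixsum_reflv.
have [F1 FF1 yF1] := cell_cover t0 P'z.
set b := face_height S F0 t y; set a := - face_height S' F1 t y.
have Pb : mixsum S t (consv b y) by exact: cell_lift.
have Pa : mixsum S t (consv a y).
  by rewrite -reflv_consv; apply: mixsum_reflvE; exact: cell_lift.
have ab : a <= b by exact: cell_max yF0 Pa.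
rewrite (bigD1 F0)//= [X in _ + X - _]big1 ?addr0; last first.
  move=> F /andP[FF FF0N]; rewrite indicE memNset ?mulr0// => yF.
  by have /eqP := hS _ _ FF FF0 FF0N; apply; exact: face_height_eq.
rewrite [X in _ - X](bigD1 F1)//= [X in _ - (_ + X)]big1 ?addr0; last first.
  move=> F /andP[FF FF1N]; rewrite indicE memNset ?mulr0// => yF.
  by have /eqP := hS' _ _ FF FF1 FF1N; apply; exact: face_height_eq.
rewrite !indicE !mem_set// !mulr1 -(FTC _ _ ab) [RHS]integral_indicE.
apply: eq_integral => x _; congr (_ * _)%:E.
rewrite !indicE; congr ((nat_of_bool _)%:R); apply/idP/idP; rewrite !inE /= in_itv /=.
  move=> Px; rewrite (cell_max t0 FF0 yF0 Px) andbT lerNl.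
  by apply: (cell_max t0 FF1 yF1); rewrite -reflv_consv; exact: mixsum_reflv.
(* A section consisting of one point is treated apart, since the convex weight below divides by b -
   a. *)
move=> /andP[ax xb]; have [ba|ba] := eqVneq a b.
  by rewrite (_ : x = b) //; apply/eqP; rewrite eq_le xb -ba ax.
have ab' : 0 < b - a by rewrite subr_gt0 lt_neqAle ba ab.
have -> : consv x y = ((x - a) / (b - a)) *: consv b y + (1 - (x - a) / (b - a)) *: consv a y.
  apply/rowP => i; rewrite [RHS]mxE [X in _ = X + _]mxE [X in _ = _ + X]mxE.
  case: (unliftP ord0 i) => [j|] ->; first by rewrite !consvS; ring.
  by rewrite !consv0; field; rewrite gt_eqF.
apply: mixsum_convex => //; first by rewrite divr_ge0 ?subr_ge0.
by rewrite ler_pdivrMr// mul1r lerD2r.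
Qed.

End HeightIntegration.

(** One polynomial [h] serves for all t because the set of faces depends on the points [S] only. The
    degree grows by one with each coordinate integrated out. *)
Lemma hpoly_integral m N n d (S : 'I_m -> 'I_N.+1 -> 'rV[R]_n) q : hpoly d q ->
  exists2 h : ('I_m -> R) -> 'rV[R]_0 -> R, hpoly (d + n) h &
  forall t, (forall i, 0 <= t i) ->
   (\int[mu R n]_(w in @emb R n @^-1` mixsum S t) (q t (emb w))%:E = (h t 0)%:E)%E.
Proof.
elim: n d S q => [|n IH] d S q hq.
  exists q; first by rewrite addn0.
  move=> t t0; rewrite (_ : _ @^-1` _ = setT); last first.
    apply/seteqP; split => // w _ /=; have [v Pv] := mixsum_neq0 S t.
    by rewrite (_ : 0 = v)//; apply/rowP => -[].
  by rewrite integral_dirac// diracE mem_set// mul1e.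
have [Q hQ FTC] := hpoly_FTC hq.
pose S' i j := reflv (S i j).
have /boolp.choice[h1 h1P] F : exists h : ('I_m -> R) -> 'rV[R]_0 -> R,
    hpoly (d.+1 + n) h /\ forall t, (forall i, 0 <= t i) ->
    (\int[mu R n]_(w in @emb R n @^-1` cell S F t)
       (Q t (consv (face_height S F t (emb w)) (emb w)))%:E = (h t 0)%:E)%E.
  by have [h h_hpoly hP] := IH _ (face_pts S F) _ (hpoly_top S hQ F); exists h.
have /boolp.choice[h2 h2P] F : exists h : ('I_m -> R) -> 'rV[R]_0 -> R,
    hpoly (d.+1 + n) h /\ forall t, (forall i, 0 <= t i) ->
    (\int[mu R n]_(w in @emb R n @^-1` cell S' F t)
       (Q t (consv (- face_height S' F t (emb w)) (emb w)))%:E = (h t 0)%:E)%E.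
  by have [h h_hpoly hP] := IH _ (face_pts S' F) _ (hpoly_bot S hQ F); exists h.
exists (fun t y => \sum_(F | is_face S F) h1 F t y + - \sum_(F | is_face S' F) h2 F t y).
  rewrite addnS -addSn; apply: hpolyD; last apply: hpolyN;
  by apply: hpoly_sum => F _; have [] := h1P F; have [] := h2P F.
move=> t t0; rewrite integral_indicE.
have ig := integrable_hpoly t hq (@mixsum_compact _ _ _ _ S t).
have mg := measurable_int _ ig.
rewrite -(integral21_prod_meas1 (m1 := lebesgue_measure) (m2 := mu R n) ig).
pose u F (w : sp R n) := Q t (consv (face_height S F t (emb w)) (emb w)) *
  \1_(@emb R n @^-1` cell S F t) w.
pose v F (w : sp R n) := Q t (consv (- face_height S' F t (emb w)) (emb w)) *
  \1_(@emb R n @^-1` cell S' F t) w.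
have iu F : (mu R n).-integrable setT (EFin \o u F).
  exact: (integrable_hpoly t (hpoly_top S hQ F) (@cell_compact _ _ _ _ S F t)).
have iv F : (mu R n).-integrable setT (EFin \o v F).
  exact: (integrable_hpoly t (hpoly_bot S hQ F) (@cell_compact _ _ _ _ S' F t)).
have isum (P : pred _) (f : _ -> sp R n -> R) :
    (forall F, (mu R n).-integrable setT (EFin \o f F)) ->
    (mu R n).-integrable setT (fun w => (\sum_(F | P F) f F w)%:E).
  move=> hf; under eq_fun do rewrite -sumEFin.
  by apply: integrable_sum => // F _; exact: hf.
have Isum (P : pred _) (f : _ -> sp R n -> R) :
    (forall F, (mu R n).-integrable setT (EFin \o f F)) ->
    (\int[mu R n]_w (\sum_(F | P F) f F w)%:E = \sum_(F | P F) \int[mu R n]_w (f F w)%:E)%E.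
  move=> hf; under eq_integral do rewrite -sumEFin.
  by apply: integral_sum => // F; exact: hf.
transitivity (\int[mu R n]_w ((\sum_(F | is_face S F) u F w)%:E -
    (\sum_(F | is_face S' F) v F w)%:E))%E.
  apply: ae_eq_integral => //.
  - exact: (measurable_fubini_G (m1 := lebesgue_measure) (m2 := mu R n) ig).
  - by apply: emeasurable_funB; apply: measurable_int; exact: isum.
  - have FF : Filter (nbhs (almost_everywhere (mu R n))) by exact: ae_filter_ringOfSetsType.
    have := filterI (ae_distinct_heights S t) (ae_distinct_heights S' t) => H.
    rewrite /ae_eq; apply: (filterS _ (H FF)) => w [hw hw'] _.
    by rewrite /fubini_G (inner_integral FTC).
rewrite integralB_EFin//; [|exact: isum|exact: isum].
rewrite !Isum// EFinB -!sumEFin; congr (_ - _)%E; apply: eq_bigr => F _.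
  by rewrite -(h1P F).2// [RHS]integral_indicE.
by rewrite -(h2P F).2// [RHS]integral_indicE.
Qed.

End IntegralPolytopes.

(** * Polarization and existence of mixed volumes *)

Section Polarization.
Variable R : realType.

(* Subsets [S] of indices are boolean functions; [sgnf S] is (-1)^(n - |S|), the
   sign of [S] in the polarization formula. *)
Definition sgnf n (S : {ffun 'I_n -> bool}) : R := \prod_k (if S k then 1 else -1).

(** The sum over subsets factors over k. The factor at k is 1 when k lies in the image of u and 1 -
    1 = 0 otherwise, so only surjective, that is injective, u survive. *)
Lemma sum_sgnf n (u : {ffun 'I_n -> 'I_n}) :
  \sum_S sgnf S * \prod_l (S (u l))%:R = (injectiveb u)%:R.
Proof.
have E (S : {ffun 'I_n -> bool}) : sgnf S * \prod_l (S (u l))%:R =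
    \prod_k ((if S k then 1 else -1) * ((k \in codom u) ==> S k)%:R).
  rewrite big_split /=; congr (_ * _); rewrite -!natr_prod; congr (_%:R).
  have [/forallP H|] := boolP [forall l, S (u l)].
    rewrite !big1// => [k _|l _]; last by rewrite H.
    by case: (boolP (k \in codom u)) => //= /codomP[l ->]; rewrite H.
  rewrite negb_forall => /existsP[l /negbTE Sl].
  by rewrite (bigD1 l)//= Sl mul0n (bigD1 (u l))//= codom_f Sl.
under eq_bigr do rewrite E.
rewrite -(bigA_distr_bigA (fun k b => (if b then 1 else -1) * ((k \in codom u) ==> b)%:R : R)).
under eq_bigr do rewrite big_bool /= implybT implybF mul1r mulN1r.
have [/injectiveP inju|ninju] := boolP (injectiveb u).
  rewrite big1// => k _; have /codomP[l ->] : k \in codom u by exact: (injF_onto inju).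
  by rewrite codom_f subr0.
have [k /negbTE kN] : exists k, k \notin codom u.
  apply/existsP; rewrite -negb_forall; apply: contra ninju => /forallP H.
  apply/(@card_uniqP _ (codom u)); rewrite size_codom.
  by apply: eq_card => k; rewrite H.
by rewrite (bigD1 k)//= kN subrr mul0r.
Qed.

Lemma sum_injective n (c : R) :
  \sum_(u : {ffun 'I_n -> 'I_n}) (injectiveb u)%:R * c = n`!%:R * c.
Proof.
rewrite -mulr_suml; congr (_ * _); rewrite -natr_sum; congr (_%:R).
have -> : (\sum_(u : {ffun 'I_n -> 'I_n}) injectiveb u =
    \sum_(u : {ffun 'I_n -> 'I_n} | injectiveb u) 1)%N.
  by rewrite [RHS]big_mkcond; apply: eq_bigr => u _; case: ifP.
rewrite sum1dep_card -[RHS]ffactnn.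
by have := card_inj_ffuns 'I_n 'I_n; rewrite card_ord.
Qed.

(** The vector given by the sum, over k in S, of the basis vectors e_(f k). *)
Definition indic_comb n m (S : {ffun 'I_n -> bool}) (f : {ffun 'I_n -> 'I_m}) i : R :=
  \sum_(k | f k == i) (S k)%:R.

(** For a form V of degree n, the inner sum is n! times its symmetric multilinear form at the basis
    vectors e_(f k). *)
Definition polarized n m (V : ('I_m -> R) -> R) (t : 'I_m -> R) :=
  n`!%:R * V t = \sum_(f : {ffun 'I_n -> 'I_m})
    (\prod_k t (f k)) * \sum_S sgnf S * V (indic_comb S f).

(** Expanding the monomial at [indic_comb S f] and summing over S leaves the number of permutations
    u with f o u = g. Each u then contributes exactly one f. *)
Lemma polarized_monomial n m (g : 'I_n -> 'I_m) t :
  polarized n (fun t => \prod_l t (g l)) t.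
Proof.
rewrite /polarized /=.
have E (f : {ffun 'I_n -> 'I_m}) :
    \sum_S sgnf S * \prod_l indic_comb S f (g l) =
    \sum_(u : {ffun 'I_n -> 'I_n}) (injectiveb u)%:R * \prod_l (f (u l) == g l)%:R.
  transitivity (\sum_S \sum_(u : {ffun 'I_n -> 'I_n})
      sgnf S * (\prod_l (S (u l))%:R) * \prod_l (f (u l) == g l)%:R).
    apply: eq_bigr => S _; rewrite /indic_comb.
    under eq_bigr do rewrite big_mkcond /=.
    rewrite bigA_distr_bigA mulr_sumr; apply: eq_bigr => u _.
    rewrite -[RHS]mulrA; congr (_ * _); rewrite -big_split /=; apply: eq_bigr => l _.
    by case: eqP => _; rewrite ?mulr1 ?mulr0.
  rewrite exchange_big /=; apply: eq_bigr => u _.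
  by rewrite -mulr_suml sum_sgnf.
transitivity (\sum_(f : {ffun 'I_n -> 'I_m}) \sum_(u : {ffun 'I_n -> 'I_n})
    (\prod_k t (f k)) * ((injectiveb u)%:R * \prod_l (f (u l) == g l)%:R)); last first.
  by apply: eq_bigr => f _; rewrite -mulr_sumr; congr (_ * _); rewrite -E.
rewrite exchange_big -sum_injective /=; apply: eq_bigr => u _.
have [/injectiveP inju|] := boolP (injectiveb u); last first.
  by rewrite mul0r big1// => f _; rewrite mul0r mulr0.
(* The only f with f o u = g is g o u^-1. *)
rewrite mul1r (bigD1 [ffun k => g (invF inju k)])//= [X in _ + X]big1 ?addr0.
  rewrite mul1r [X in _ * X]big1 ?mulr1.
    rewrite [RHS](reindex_inj inju) /=; apply: eq_bigr => l _.
    by rewrite ffunE invF_f.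
  by move=> l _; rewrite ffunE invF_f eqxx.
move=> f fN; have [l fl] : exists l, f (u l) != g l.
  apply/existsP; rewrite -negb_forall; apply: contra fN => /forallP H.
  apply/eqP/ffunP => k; rewrite ffunE -(eqP (H (invF inju k))).
  by rewrite f_invF.
by rewrite [X in _ * (_ * X)](bigD1 l)//= (negbTE fl) mul0r !mulr0.
Qed.

Lemma polarizedD n m (V W : ('I_m -> R) -> R) t :
  polarized n V t -> polarized n W t -> polarized n (fun t => V t + W t) t.
Proof.
rewrite /polarized mulrDr => -> ->; rewrite -big_split /=; apply: eq_bigr => f _.
rewrite -mulrDr -big_split /=; congr (_ * _); apply: eq_bigr => S _.
by rewrite mulrDr.
Qed.

Lemma polarizedZ n m c (V : ('I_m -> R) -> R) t :
  polarized n V t -> polarized n (fun t => c * V t) t.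
Proof.
rewrite /polarized mulrCA => ->; rewrite mulr_sumr; apply: eq_bigr => f _.
rewrite mulrCA; congr (_ * _); rewrite mulr_sumr; apply: eq_bigr => S _.
by rewrite mulrCA.
Qed.

Lemma polarized0 n m t : @polarized n m (fun=> 0) t.
Proof.
rewrite /polarized mulr0 big1// => f _.
by rewrite [X in _ * X]big1 ?mulr0// => S _; rewrite mulr0.
Qed.

Lemma hpoly_monomials m d (h : ('I_m -> R) -> 'rV[R]_0 -> R) : hpoly d h ->
  exists L : seq (R * d.-tuple 'I_m),
    forall t y, h t y = \sum_(p <- L) p.1 * \prod_l t (tnth p.2 l).
Proof.
elim => {d h}.
- by move=> d; exists [::] => t y; rewrite big_nil.
- move=> c; exists [:: (c, [tuple])] => t y.
  by rewrite big_seq1 big_ord0 mulr1.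
- move=> i; exists [:: (1, [tuple i])] => t y.
  by rewrite big_seq1 big_ord1 mul1r.
- by case.
- move=> d p q _ [L HL] _ [L' HL']; exists (L ++ L') => t y.
  by rewrite big_cat HL HL'.
- move=> d e p q _ [L HL] _ [L' HL'].
  exists [seq (a.1 * b.1, cat_tuple a.2 b.2) |
    a : R * d.-tuple 'I_m <- L, b : R * e.-tuple 'I_m <- L'] => t y.
  rewrite HL HL' big_allpairs_dep /= mulr_suml; apply: eq_bigr => a _.
  rewrite mulr_sumr; apply: eq_bigr => b _ /=.
  rewrite mulrACA; congr (_ * _).
  rewrite -!(big_tuple _ _ _ xpredT t) /=.
  by rewrite big_cat.
Qed.

Lemma hpoly_polarized m d (h : ('I_m -> R) -> 'rV[R]_0 -> R) t : hpoly d h ->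
  polarized d (fun t => h t 0) t.
Proof.
move=> /hpoly_monomials[L HL].
have -> : (fun t => h t 0) = (fun t => \sum_(p <- L) p.1 * \prod_l t (tnth p.2 l)).
  by apply/funext => t'; rewrite HL.
elim: L {HL} => [|p L IH].
  by under eq_fun do rewrite big_nil; exact: polarized0.
under eq_fun do rewrite big_cons; apply: polarizedD IH.
exact: (@polarizedZ _ _ p.1 (fun t => \prod_l t (tnth p.2 l))) (polarized_monomial _ _).
Qed.

End Polarization.

(** * Outer approximation by polytopes and continuity of volume *)

Section MixedVolume.
Variable R : realType.

(** For convex K and nonnegative s, s', a weighted average shows sK + s'K = (s + s')K. Nonemptiness
    supplies a point when the total weight of a class is 0. *)
Lemma mink_comb_regroup d n m (s : 'I_n -> R) (f : 'I_n -> 'I_m)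
    (K : 'I_m -> set 'rV[R]_d) :
  (forall k, 0 <= s k) -> (forall i, convex (K i)) -> (forall i, K i !=set0) ->
  mink_comb s (fun k => K (f k)) = mink_comb (fun i => \sum_(k | f k == i) s k) K.
Proof.
move=> s0 cK K0; apply/seteqP; split => x; last first.
  move=> [y [Ky ->]]; exists (fun k => y (f k)); split => //.
  rewrite [RHS](partition_big f xpredT)//=; apply: eq_bigr => i _.
  by rewrite scaler_suml; apply: eq_bigr => k /eqP ->.
move=> [y [Ky ->]].
have H i : exists z, K i z /\ \sum_(k | f k == i) s k *: y k = (\sum_(k | f k == i) s k) *: z.
  set c := \sum_(k | f k == i) s k.
  have [c0|c0] := eqVneq c 0.
    have [z Kz] := K0 i; exists z; split => //.
    rewrite c0 scale0r big1// => k fk.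
    have /eqP := c0; rewrite psumr_eq0// => /allP /(_ k (mem_index_enum k)).
    by rewrite fk => /eqP ->; rewrite scale0r.
  exists (\sum_(k <- [seq k <- index_enum 'I_n | f k == i]) (s k / c) *: y k); split.
    apply: convex_sum => //.
    - by move=> k _; rewrite divr_ge0// sumr_ge0.
    - by rewrite big_filter -mulr_suml divff.
    - by move=> k; rewrite mem_filter => /andP[/eqP <- _].
  rewrite big_filter scaler_sumr; apply: eq_bigr => k _.
  by rewrite scalerA mulrCA divff// mulr1.
have [z zP] := boolp.choice H; exists z; split => [i|]; first by have [] := zP i.
rewrite (partition_big f xpredT)//=; apply: eq_bigr => i _.
by have [_ ->] := zP i.
Qed.

Lemma VolE n (A : set 'rV[R]_n) : compact A ->
  (Vol A)%:E = mu R n (@emb R n @^-1` A).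
Proof.
by move=> cA; rewrite /Vol vol_eE fineK// ge0_fin_numE// mu_compact_fin.
Qed.

Lemma Vol_le n (A B : set 'rV[R]_n) : compact A -> compact B -> A `<=` B ->
  Vol A <= Vol B.
Proof.
move=> cA cB AB; rewrite -lee_fin !VolE//; apply: le_measure;
  rewrite ?inE; try exact: measurable_compact.
by move=> w /=; exact: AB.
Qed.

(* The sup-norm analogue of [thicken]. *)
Definition thick n (A : set 'rV[R]_n) (r : R) : set 'rV[R]_n :=
  [set x | exists2 y, A y & `|x - y| <= r].

Lemma thick_compact n (A : set 'rV[R]_n) r : 0 <= r -> compact A -> compact (thick A r).
Proof.
move=> r0 cA.
have -> : thick A r = (fun p => p.1 + p.2) @`
   (A `*` [set v : 'rV[R]_n | forall i, `[- r, r]%classic (v 0 i)]).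
  apply/seteqP; split => x.
    move=> [y Ay xy]; exists (y, x - y); last by rewrite /= addrC subrK.
    split => //= i; rewrite in_itv /= -ler_norml.
    exact: le_trans (rv_norm_coord _ _) xy.
  move=> [[y v] [/= Ay vr] <-]; exists y => //; rewrite addrAC subrr add0r.
  by apply/rv_normP => // i; have := vr i; rewrite /= in_itv /= -ler_norml.
apply: continuous_compact.
  apply: continuous_subspaceT => p.
  by apply: (@continuousD _ _ _ fst snd); [exact: cvg_fst|exact: cvg_snd].
apply: compact_setX => //.
by apply: (@rV_compact R n (fun=> `[- r, r]%classic)) => j; exact: segment_compact.
Qed.

Lemma thick_convex n (A : set 'rV[R]_n) r : convex A -> convex (thick A r).
Proof.
move=> cA x y t [x' Ax xx'] [y' Ay yy'] t0 t1.
exists (t *: x' + (1 - t) *: y'); first exact: cA.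
rewrite opprD addrACA -!scalerBr (le_trans (ler_normD _ _))// !normrZ.
rewrite !ger0_norm ?subr_ge0//.
have : t * `|x - x'| + (1 - t) * `|y - y'| <= t * r + (1 - t) * r.
  by rewrite lerD// ler_wpM2l// subr_ge0.
by move=> /le_trans; apply; rewrite -mulrDl addrCA subrr addr0 mul1r.
Qed.

(** Continuity of the measure from above: the thickenings decrease to [A] because [A] is closed. *)
Lemma Vol_thick_cvg n (A : set 'rV[R]_n) C : 0 <= C -> compact A ->
  Vol (thick A (C * k.+1%:R^-1)) @[k --> \oo] --> Vol A.
Proof.
move=> C0 cA.
have r0 k : 0 <= C * k.+1%:R^-1 by rewrite mulr_ge0.
have cT k := thick_compact (r0 k) cA.
pose F k := @emb R n @^-1` thick A (C * k.+1%:R^-1).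
have FA : \bigcap_k F k = @emb R n @^-1` A.
  apply/seteqP; split => [w wF|w Aw k _]; last first.
    by exists (emb w) => //; rewrite subrr normr0.
  apply: (compact_closed (@norm_hausdorff _ _) cA).
  move=> B /nbhs_ballP[r /= rgt0 rB].
  (* C + 1 instead of C, which may be 0. *)
  have [k kr] := exists_natinv_lt (divr_gt0 rgt0 (ltr_pwDr ltr01 C0)).
  have [y Ay yw] := wF k I; exists y; split => //.
  apply: rB; rewrite -ball_normE /ball_ /=; apply: le_lt_trans yw _.
  apply: (@le_lt_trans _ _ ((C + 1) * k.+1%:R^-1)).
    by rewrite ler_pM2r ?invr_gt0// lerDl.
  by rewrite mulrC -ltr_pdivlMr// ltr_wpDl.
have : mu R n \o F @ \oo --> mu R n (\bigcap_k F k).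
  apply: nonincreasing_cvg_mu.
  - exact: mu_compact_fin (cT 0%N).
  - by move=> k; exact: measurable_compact (cT k).
  - by rewrite FA; exact: measurable_compact.
  - move=> k l kl; apply/subsetPset => w [y Ay yw]; exists y => //.
    apply: le_trans yw _; rewrite ler_wpM2l// lef_pV2 ?posrE ?ltr0n//.
    by rewrite ler_nat ltnS.
rewrite FA -VolE//.
have -> : mu R n \o F = EFin \o (fun k => Vol (thick A (C * k.+1%:R^-1))).
  by apply/funext => k /=; rewrite VolE.
by move/fine_cvgP => [_].
Qed.

(** Around each point of a net of mesh e/n the cross-polytope of radius e is placed: it contains the
    sup-norm ball of radius e/n and stays within e of K. Any larger number of points is allowed as
    well, so that several bodies can use a common one. *)
Lemma polytope_approx n (K : set 'rV[R]_n) (e : R) : (0 < n)%N -> 0 < e ->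
  cc_body K -> exists N0, forall N, (N0 <= N)%N -> exists P : 'I_N.+1 -> 'rV[R]_n,
    K `<=` conv_pts P /\ conv_pts P `<=` thick K e.
Proof.
move=> n0 e0 [[x0 Kx0] [cK vK]].
have nR : 0 < n%:R :> R by rewrite ltr0n.
pose d := e / n%:R.
have d0 : 0 < d by rewrite divr_gt0.
have [s [sK sP]] := compact_net d0 cK.
pose pt (x : 'rV[R]_n) (i : 'I_n) (b : bool) := x + (if b then e else - e) *: delta_mx 0 i.
pose L := [seq pt x ib.1 ib.2 | x <- s, ib <- enum {: 'I_n * bool}].
have LK p : p \in L -> thick K e p.
  move=> /allpairsP[[x [i b]] [/= xs _ ->]]; exists x; first exact: sK.
  apply/rv_normP => [|j]; first exact: ltW.
  rewrite !mxE addrAC subrr add0r normrM.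
  have -> : `|if b then e else - e| = e by case: b; rewrite ?normrN gtr0_norm.
  by case: (j == i); rewrite ?normr1 ?mulr1// normr0 mulr0 ltW.
(* Surplus indices receive the default [x0], a point of K. *)
exists (size L) => N LN; pose P (j : 'I_N.+1) := nth x0 L j.
have KeP j : thick K e (P j).
  have [jL|jL] := ltnP j (size L); first by apply: LK; exact: mem_nth.
  by rewrite /P nth_default//; exists x0 => //; rewrite subrr normr0 ltW.
have LP p : p \in L -> conv_pts P p.
  move=> pL; have iN : (index p L < N.+1)%N.
    by rewrite (leq_trans _ (leqW LN))// index_mem.
  have <- : P (Ordinal iN) = p by rewrite /P /= nth_index.
  exact: conv_pts_mem.
exists P; split; last exact: conv_pts_min (thick_convex vK) KeP.
move=> y /sP[x xs yx].
(* y is the average of n points, each displaced from x along one axis by n times the corresponding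
   coordinate of y - x. *)
have -> : y = \sum_(i < n) n%:R^-1 *: (x + (n%:R * (y - x) 0 i) *: delta_mx 0 i).
  apply/rowP => j; rewrite summxE.
  under eq_bigr do rewrite !mxE mulrDr.
  rewrite big_split /= sumr_const card_ord -[X in _ = X + _]mulr_natr mulrAC mulVf ?gt_eqF// mul1r.
  rewrite (bigD1 j)//= eqxx mulr1 mulrA mulVf ?gt_eqF// mul1r big1 ?addr0.
    by ring.
  by move=> i /negbTE ij; rewrite eq_sym ij !mulr0.
apply: convex_sum; first exact: conv_pts_convex.
- by move=> i _; rewrite invr_ge0 ltW.
- by rewrite sumr_const card_ord -[LHS]mulr_natr mulVf// gt_eqF.
move=> i _; set a := n%:R * _.
have ae : `|a| <= e.
  rewrite /a normrM gtr0_norm// mulrC -ler_pdivlMr//.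
  exact: le_trans (rv_norm_coord _ _) (ltW yx).
have memL b : conv_pts P (pt x i b).
  apply: LP; apply/allpairsP; exists (x, (i, b)); split => //=.
  by rewrite mem_enum.
move: ae; rewrite ler_norml => /andP[ea ae].
(* The weight at which x + e e_i and x - e e_i combine to x + a e_i. *)
have := conv_pts_convex (memL true) (memL false) (t := (a + e) / (2 * e)).
have e2 : 0 < 2 * e by rewrite mulr_gt0.
rewrite divr_ge0 ?(ltW e2) -?lerBlDr ?sub0r//.
rewrite ler_pdivrMr// mul1r mulr2n mulrDl !mul1r lerD2r => /(_ isT ae).
congr conv_pts; rewrite /pt; apply/rowP => j; rewrite !mxE.
by field; rewrite gt_eqF ?addr_gt0.
Qed.

End MixedVolume.

(** * Minkowski's theorem for convex bodies *)

Section MixedVolumeExistence.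
Variable R : realType.

Lemma mink_comb_cc n m (t : 'I_m -> R) (K : 'I_m -> set 'rV[R]_n) :
  (forall i, cc_body (K i)) -> cc_body (mink_comb t K).
Proof.
move=> cK; split; [|split].
- by apply: mink_comb_neq0 => i; have [] := cK i.
- by apply: mink_comb_compact => i; have [_ []] := cK i.
- by apply: mink_comb_convex => i; have [_ []] := cK i.
Qed.

Lemma mink_comb_sub n m (t : 'I_m -> R) (K L : 'I_m -> set 'rV[R]_n) :
  (forall i, K i `<=` L i) -> mink_comb t K `<=` mink_comb t L.
Proof. by move=> KL x [y [Ky ->]]; exists y; split => // i; exact: KL. Qed.

Lemma mink_comb_thick n m (t : 'I_m -> R) (K L : 'I_m -> set 'rV[R]_n) e :
  (forall i, 0 <= t i) -> (forall i, L i `<=` thick (K i) e) ->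
  mink_comb t L `<=` thick (mink_comb t K) ((\sum_i t i) * e).
Proof.
move=> t0 LK x [y [Ly ->]].
have /boolp.choice[z Kz] i : exists z, K i z /\ `|y i - z| <= e.
  by have [z Kz yz] := LK i (y i) (Ly i); exists z.
exists (\sum_i t i *: z i); first by exists z; split => // i; have [] := Kz i.
rewrite -sumrB mulr_suml (le_trans (ler_norm_sum _ _ _))//; apply: ler_sum => i _.
rewrite -scalerBr normrZ ger0_norm// ler_wpM2l//.
by have [] := Kz i.
Qed.

Lemma Vol_approx n m (K : 'I_m -> set 'rV[R]_n) e : (0 < n)%N -> 0 < e ->
  (forall i, cc_body (K i)) ->
  exists W : ('I_m -> R) -> R, (forall t, polarized n W t) /\
    forall t, (forall i, 0 <= t i) ->
    Vol (mink_comb t K) <= W t <= Vol (thick (mink_comb t K) ((\sum_i t i) * e)).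
Proof.
move=> n0 e0 cK.
have [N0 N0P] := boolp.choice (fun i => polytope_approx n0 e0 (cK i)).
(* Any common upper bound of the thresholds would do. *)
pose N := (\sum_i N0 i)%N.
have N0N i : (N0 i <= N)%N by rewrite /N (bigD1 i)//= leq_addr.
have [P PP] := boolp.choice (fun i => N0P i N (N0N i)).
have [h hh hP] := hpoly_integral P (hpolyC m n (1 : R)).
exists (fun t => h t 0); split => [t|t t0].
  exact: (hpoly_polarized t hh).
have -> : h t 0 = Vol (mixsum P t).
  apply: EFin_inj; rewrite -hP// integral_cst; last first.
    by apply: measurable_compact; exact: mixsum_compact.
  by rewrite mul1e VolE//; exact: mixsum_compact.
have [_ [cM _]] := mink_comb_cc t cK.
apply/andP; split; apply: Vol_le => //; try exact: mixsum_compact.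
- by apply: mink_comb_sub => i; have [] := PP i.
- by apply: thick_compact => //; rewrite mulr_ge0 ?sumr_ge0// ltW.
- by apply: mink_comb_thick => // i; have [] := PP i.
Qed.

Lemma cvg_bigsum (I : Type) (r : seq I) (f : I -> nat -> R) (l : I -> R) :
  (forall i, f i k @[k --> \oo] --> l i) ->
  (\sum_(i <- r) f i k) @[k --> \oo] --> \sum_(i <- r) l i.
Proof.
move=> fl; elim: r => [|i r IH].
  by under eq_fun do rewrite big_nil; rewrite big_nil; exact: cvg_cst.
under eq_fun do rewrite big_cons.
by rewrite big_cons; apply: cvgD.
Qed.

Lemma indic_comb_ge0 n m (S : {ffun 'I_n -> bool}) (f : {ffun 'I_n -> 'I_m}) i :
  0 <= indic_comb R S f i.
Proof. by apply: sumr_ge0 => k _. Qed.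

(** Polarization evaluates volumes only at the vectors [indic_comb S f], which are nonnegative;
    there the polynomials of [Vol_approx] converge to the volume. *)
Lemma Vol_polarized n m (K : 'I_m -> set 'rV[R]_n) t : (0 < n)%N ->
  (forall i, cc_body (K i)) -> (forall i, 0 <= t i) ->
  polarized n (fun t => Vol (mink_comb t K)) t.
Proof.
move=> n0 cK t0.
have e0 k : 0 < k.+1%:R^-1 :> R by rewrite invr_gt0.
have [W WP] := boolp.choice (fun k => Vol_approx n0 (e0 k) cK).
have Wcvg s : (forall i, 0 <= s i) -> W k s @[k --> \oo] --> Vol (mink_comb s K).
  move=> s0; have [_ [cM _]] := mink_comb_cc s cK.
  apply: (squeeze_cvgr _ (cvg_cst (Vol (mink_comb s K)))
    (Vol_thick_cvg (sumr_ge0 _ (fun i _ => s0 i)) cM)).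
  by apply: nearW => k; have [_] := WP k; exact.
have L : n`!%:R * W k t @[k --> \oo] --> n`!%:R * Vol (mink_comb t K).
  by apply: cvgMl_tmp; exact: Wcvg.
apply: (cvg_unique _ L) => //.
have -> : (fun k => n`!%:R * W k t) = (fun k => \sum_(f : {ffun 'I_n -> 'I_m})
    (\prod_k (t (f k))) * \sum_S sgnf R S * W k (indic_comb R S f)).
  by apply/funext => k; exact: (WP k).1.
apply: cvg_bigsum => f; apply: cvgMl_tmp; apply: cvg_bigsum => S.
by apply: cvgMl_tmp; apply: Wcvg => i; exact: indic_comb_ge0.
Qed.

Definition polar_volume n (K : 'I_n -> set 'rV[R]_n) : R :=
  n`!%:R^-1 * \sum_(S : {ffun 'I_n -> bool})
    sgnf R S * Vol (mink_comb (fun k => (S k)%:R) K).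

Lemma fact_neq0 n : n`!%:R != 0 :> R.
Proof. by rewrite pnatr_eq0 -lt0n fact_gt0. Qed.

Lemma polar_volume_mixed n : (0 < n)%N -> is_mixed_volume (@polar_volume n).
Proof.
move=> n0; split => [s K cK|K t cK t0]; last first.
  apply: (mulfI (fact_neq0 n)); rewrite (Vol_polarized n0 cK t0) mulr_sumr.
  apply: eq_bigr => f _; rewrite mulrCA; congr (_ * _).
  rewrite mulrA divff ?fact_neq0// mul1r; apply: eq_bigr => S _; congr (_ * Vol _).
  rewrite [RHS]mink_comb_regroup// => i; have [? [? ?]] := cK i => //.
congr (_ * _).
rewrite (reindex_inj (h := fun S : {ffun 'I_n -> bool} => [ffun k => S (s k)])) /=; last first.
  move=> S T /ffunP ST; apply/ffunP => k.
  by have := ST (s^-1%g k); rewrite !ffunE permKV.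
apply: eq_bigr => S _.
have -> : sgnf R [ffun k => S (s k)] = sgnf R S.
  rewrite /sgnf [RHS](reindex_inj (@perm_inj _ s)) /=.
  by apply: eq_bigr => k _; rewrite ffunE.
have -> // : mink_comb (fun k => ([ffun k0 => S (s k0)] k)%:R) (K \o s) =
    mink_comb (fun k => (S k)%:R) K.
rewrite [LHS](@mink_comb_regroup _ _ _ _ _ s K) => [|k//|i|i]; last 2 first.
- by have [_ []] := cK i.
- by have [] := cK i.
congr mink_comb; apply/funext => i.
rewrite (big_pred1 (s^-1%g i)) => [|k]; first by rewrite ffunE permKV.
by rewrite /= -(inj_eq (@perm_inj _ s)) permKV.
Qed.

Lemma mixed_volume_exists n : (0 < n)%N -> is_mixed_volume (@MV R n).
Proof.
move=> n0; apply: (epsilon_spec (inhabits (fun=> 0)) (@is_mixed_volume R n)).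
by exists (@polar_volume n); exact: polar_volume_mixed.
Qed.

(** Uniqueness of the mixed volume: each volume is expanded by the defining identity, only
    permutations survive the signed sum, and by symmetry they give n! equal terms. *)
Lemma MV_polar n (K : 'I_n -> set 'rV[R]_n) : (0 < n)%N ->
  (forall i, cc_body (K i)) ->
  n`!%:R * MV K = \sum_(S : {ffun 'I_n -> bool})
    sgnf R S * Vol (mink_comb (fun k => (S k)%:R) K).
Proof.
move=> n0 cK; have [symMV polMV] := mixed_volume_exists n0.
transitivity (\sum_(S : {ffun 'I_n -> bool}) \sum_(f : {ffun 'I_n -> 'I_n})
   sgnf R S * (\prod_k (S (f k))%:R) * MV (fun k => K (f k))); last first.
  apply: eq_bigr => S _; rewrite polMV// mulr_sumr.
  by apply: eq_bigr => f _; rewrite mulrA.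
rewrite exchange_big -sum_injective /=; apply: eq_bigr => f _.
rewrite -mulr_suml sum_sgnf.
have [/injectiveP injf|] := boolP (injectiveb f); last by rewrite !mul0r.
rewrite !mul1r -(symMV (perm injf) K cK); congr MV.
by apply/funext => k /=; rewrite permE.
Qed.

End MixedVolumeExistence.

(** * Upper and lower bounds *)

Section Distances.
Variable R : realType.

(** Homogeneity of the volume, read off from mixed volumes: with all bodies equal to K the expansion
    is (sum t)^n MV(K, ..., K), and t = (1, 0, ..., 0) identifies the constant as Vol K. *)
Lemma Vol_mink_const n (K : set 'rV[R]_n) (t : 'I_n -> R) : (0 < n)%N ->
  cc_body K -> (forall i, 0 <= t i) ->
  Vol (mink_comb t (fun=> K)) = (\sum_i t i) ^+ n * Vol K.
Proof.
move=> n0 cK.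
have H (s : 'I_n -> R) : (forall i, 0 <= s i) ->
    Vol (mink_comb s (fun=> K)) = (\sum_i s i) ^+ n * MV (fun _ : 'I_n => K).
  move=> s0; rewrite ((mixed_volume_exists R n0).2 (fun=> K) s (fun=> cK) s0).
  rewrite -mulr_suml -(bigA_distr_bigA (fun _ i => s i)).
  by rewrite prodr_const card_ord.
move=> t0; rewrite H//; congr (_ * _).
case: n n0 K t cK H t0 => // n _ K t cK H t0.
pose s (i : 'I_n.+1) : R := (i == ord0)%:R.
have s1 : \sum_i s i = 1.
  by rewrite (bigD1 ord0)//= /s eqxx big1 ?addr0// => i /negbTE ->.
rewrite -[LHS]mul1r -{1}(expr1n R n.+1) -s1 -H => [|i]; last exact: ler0n.
congr Vol; apply/seteqP; split => x.
  move=> [y [Ky ->]]; rewrite (bigD1 ord0)//= /s eqxx scale1r big1 ?addr0// => i /negbTE ->.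
  by rewrite scale0r.
by move=> Kx; exists (fun=> x); split => //; rewrite -scaler_suml s1 scale1r.
Qed.

Lemma cconv_union_sub n (G L : set 'rV[R]_n) : closed G -> convex G -> L `<=` G ->
  cconv_union G L = G.
Proof.
move=> clG cG LG; apply/seteqP; split => x; last by move=> Gx C [_ [_]]; apply; left.
by move=> /(_ G); apply; split => //; split => // y [|/LG].
Qed.

Lemma dG_sub n (G L : set 'rV[R]_n) : compact G -> convex G -> L `<=` G ->
  dG G G L = \sum_(0 <= j < n.+1) (MVj j G G - MVj j G L).
Proof.
move=> cG vG LG; apply: eq_bigr => j _.
rewrite cconv_union_sub//; last exact: compact_closed (@norm_hausdorff _ _) cG.
by ring.
Qed.

Lemma normr_sgnf n S : `|@sgnf R n S| = 1.
Proof.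
rewrite normr_prod big1// => k _; case: (S k); by rewrite ?normrN normr1.
Qed.

(** The sum of |S|^n over all subsets S. *)
Definition stab_const n : R := \sum_(S : {ffun 'I_n -> bool}) (\sum_k (S k)%:R) ^+ n.

(** In the polarization formula the body belonging to S lies between |S| L and |S| G, so its volume
    differs from that of |S| G by at most |S|^n (Vol G - Vol L). The factor n + 1 counts the indices
    j. *)
Lemma dG_le_Vol n (G L : set 'rV[R]_n) : (0 < n)%N -> cc_body G -> cc_body L ->
  L `<=` G ->
  dG G G L <= n.+1%:R * (n`!%:R^-1 * stab_const n) * (Vol G - Vol L).
Proof.
move=> n0 cG cL LG; have [_ [kG vG]] := cG.
rewrite dG_sub//.
apply: (@le_trans _ _ (\sum_(0 <= j < n.+1) n`!%:R^-1 * stab_const n * (Vol G - Vol L))).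
  apply: ler_sum => j _.
  rewrite -mulrA ler_pdivlMl ?ltr0n ?fact_gt0// mulrBr.
  rewrite /MVj !MV_polar//; [|by move=> k; case: ifP|by move=> k; case: ifP].
  rewrite -sumrB /stab_const mulr_suml; apply: ler_sum => S _.
  have S0 k : 0 <= (S k)%:R :> R by [].
  rewrite -mulrBr (le_trans (ler_norm _))// normrM normr_sgnf mul1r mulrBr.
  rewrite -!Vol_mink_const//.
  set A := fun k : 'I_n => if _ then G else G; set B := fun k => if _ then G else L.
  have cB k : cc_body (B k) by rewrite /B; case: ifP.
  have AG : A = (fun=> G) by apply/funext => k; rewrite /A; case: ifP.
  have LB : Vol (mink_comb (fun k => (S k)%:R) (fun=> L)) <= Vol (mink_comb (fun k => (S k)%:R) B).
    apply: Vol_le; [by have [_ []] := mink_comb_cc (fun k => (S k)%:R : R) (fun _ : 'I_n => cL)|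
     by have [_ []] := mink_comb_cc (fun k => (S k)%:R) cB|].
    by apply: mink_comb_sub => k; rewrite /B; case: ifP => _; [exact: LG|exact: subset_refl].
  have BG : Vol (mink_comb (fun k => (S k)%:R) B) <= Vol (mink_comb (fun k => (S k)%:R) (fun=> G)).
    apply: Vol_le; [by have [_ []] := mink_comb_cc (fun k => (S k)%:R) cB|
     by have [_ []] := mink_comb_cc (fun k => (S k)%:R : R) (fun _ : 'I_n => cG)|].
    by apply: mink_comb_sub => k; rewrite /B; case: ifP => _; [exact: subset_refl|exact: LG].
  by rewrite AG ger0_norm ?subr_ge0// lerD2l lerN2.
by rewrite sumr_const_nat subn0 -[leLHS]mulr_natl !mulrA lexx.
Qed.

Definition homothet n (G : set 'rV[R]_n) (x0 : 'rV[R]_n) (e : R) : set 'rV[R]_n :=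
  [set (1 - e) *: x + e *: x0 | x in G].

Lemma Vol_translate n (c : 'rV[R]_n) (A : set 'rV[R]_n) : compact A ->
  Vol [set v | A (v - c)] = Vol A.
Proof.
by move=> cA; rewrite /Vol !vol_eE mu_translate//; exact: measurable_compact.
Qed.

Lemma homothet_cc n (G : set 'rV[R]_n) x0 e : cc_body G -> cc_body (homothet G x0 e).
Proof.
move=> [[g Gg] [cG vG]]; split; [|split].
- by exists ((1 - e) *: g + e *: x0), g.
- apply: continuous_compact => //; apply: continuous_subspaceT => x.
  apply: (@continuousD _ _ _ (fun x => (1 - e) *: x) (fun=> e *: x0)); last exact: cst_continuous.
  by apply: (@continuousZl_tmp _ _ _ (fun x : 'rV[R]_n => x)).
- move=> _ _ t [x Gx <-] [y Gy <-] t0 t1.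
  exists (t *: x + (1 - t) *: y); first exact: vG.
  apply/rowP => i; rewrite !mxE; ring.
Qed.

Lemma homothet_sub n (G : set 'rV[R]_n) x0 e : convex G -> G x0 ->
  0 <= e -> e <= 1 -> homothet G x0 e `<=` G.
Proof.
move=> vG Gx0 e0 e1 _ [x Gx <-].
have := vG x x0 (1 - e) Gx Gx0; rewrite subr_ge0 e1 gerBl e0 => /(_ isT isT).
by rewrite opprB addrCA subrr addr0.
Qed.

(** The volume of the combination for S is (sum of r_k over S)^n Vol G up to a translation, and
    polarizing the n-th power of a sum leaves n! times the product of the r_k. *)
Lemma MVj_homothet n j (G : set 'rV[R]_n) x0 e : (0 < n)%N -> (j <= n)%N ->
  cc_body G -> 0 <= e -> e <= 1 ->
  MVj j G (homothet G x0 e) = (1 - e) ^+ j * Vol G.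
Proof.
move=> n0 jn cG e0 e1; apply: (mulfI (fact_neq0 R n)).
rewrite /MVj MV_polar//; last by move=> k; case: ifP => // _; exact: homothet_cc.
pose r (k : 'I_n) : R := if (k < n - j)%N then 1 else 1 - e.
have r0 k : 0 <= r k by rewrite /r; case: ifP => // _; rewrite subr_ge0.
have E (S : {ffun 'I_n -> bool}) : Vol (mink_comb (fun k => (S k)%:R)
     (fun k : 'I_n => if (k < n - j)%N then G else homothet G x0 e)) =
   \sum_(f : {ffun 'I_n -> 'I_n}) (\prod_k (S (f k))%:R) * (\prod_k r (f k)) * Vol G.
  (* The total translation contributed by the shrunken copies selected by S. *)
  pose c : 'rV[R]_n := \sum_(k < n) (S k)%:R *: (if (k < n - j)%N then 0 else e *: x0).
  transitivity (Vol (mink_comb (fun k => (S k)%:R * r k) (fun=> G))).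
    rewrite -[RHS](Vol_translate c); last first.
      by have [_ []] := mink_comb_cc (fun k => (S k)%:R * r k) (fun _ : 'I_n => cG).
    congr Vol; apply/seteqP; split => x.
      move=> [y [Ky ->]].
      have /boolp.choice[z zP] k : exists z, G z /\
          y k = r k *: z + (if (k < n - j)%N then 0 else e *: x0).
        have := Ky k; rewrite /r; case: ifP => _; last by move=> [z Gz <-]; exists z.
        by exists (y k); rewrite scale1r addr0.
      exists z; split => [k|]; first by have [] := zP k.
      rewrite /c -sumrB; apply: eq_bigr => k _.
      by have [_ ->] := zP k; rewrite scalerDr addrK scalerA.
    move=> [z [Gz xE]].
    exists (fun k => r k *: z k + (if (k < n - j)%N then 0 else e *: x0)); split => [k|].
      rewrite /r; case: ifP => _; first by rewrite scale1r addr0.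
      by exists (z k).
    rewrite -[x](subrK c) xE /c -big_split; apply: eq_bigr => k _ /=.
    by rewrite scalerDr scalerA.
  rewrite Vol_mink_const//; last by move=> k; rewrite mulr_ge0.
  rewrite -mulr_suml; congr (_ * _).
  have -> : (\sum_k (S k)%:R * r k) ^+ n = \prod_(l < n) \sum_k (S k)%:R * r k.
    by rewrite prodr_const card_ord.
  by rewrite bigA_distr_bigA; apply: eq_bigr => f _; rewrite big_split.
under eq_bigr do rewrite E mulr_sumr.
rewrite exchange_big -sum_injective /=; apply: eq_bigr => f _.
under eq_bigr do rewrite !mulrA.
rewrite -!mulr_suml sum_sgnf.
have [/injectiveP injf|] := boolP (injectiveb f); last by rewrite !mul0r.
rewrite !mul1r; congr (_ * _).
have -> : \prod_k r (f k) = \prod_k r k by rewrite [RHS](reindex_inj injf).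
rewrite /r -(big_mkord xpredT (fun k => if (k < n - j)%N then 1 else 1 - e)).
rewrite (@big_cat_nat _ _ _ (n - j))//=; last exact: leq_subr.
rewrite big_nat_cond big1 ?mul1r; last by move=> k /andP[/andP[_ ->]].
rewrite big_nat_cond (eq_bigr (fun=> 1 - e)); last first.
  by move=> k /andP[/andP[+ _] _]; rewrite leqNgt => /negbTE ->.
by rewrite -big_nat_cond prodr_const_nat subKn.
Qed.

End Distances.

(** * Hausdorff distances of shrunken and truncated bodies *)

Section HausdorffBounds.
Variable R : realType.

Lemma enorm0 n : enorm (0 : 'rV[R]_n) = 0.
Proof. by rewrite /enorm big1 ?sqrtr0// => i _; rewrite mxE expr0n. Qed.

Lemma enormZ n k (x : 'rV[R]_n) : 0 <= k -> enorm (k *: x) = k * enorm x.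
Proof.
move=> k0; rewrite /enorm -[k in RHS](ger0_norm k0) -sqrtr_sqr -sqrtrM ?sqr_ge0// mulr_sumr.
by congr Num.sqrt; apply: eq_bigr => i _; rewrite mxE exprMn.
Qed.

Lemma coord_le_enorm n (x : 'rV[R]_n) i : `|x 0 i| <= enorm x.
Proof. by rewrite -sqrtr_sqr ler_wsqrtr// sqsum_ge. Qed.

Lemma dotv_le_enorm n (a x : 'rV[R]_n) : `|dotv a x| <= (\sum_i `|a 0 i|) * enorm x.
Proof.
rewrite (le_trans (ler_norm_sum _ _ _))// mulr_suml; apply: ler_sum => i _.
by rewrite normrM ler_wpM2l// coord_le_enorm.
Qed.

Lemma enorm_diam n (G : set 'rV[R]_n) : compact G ->
  exists2 D : R, 0 < D & forall x y, G x -> G y -> enorm (x - y) <= D.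
Proof.
move=> cG; have [M [Mr MG]] := compact_bounded cG.
pose r := `|M| + 1.
have Gr x : G x -> `|x| <= r.
  by move=> Gx; apply: MG => //; rewrite (le_lt_trans (ler_norm M))// ltrDl.
exists (Num.sqrt (\sum_(i < n) (r + r) ^+ 2) + 1); first by rewrite ltr_wpDl ?sqrtr_ge0.
move=> x y Gx Gy; apply: (@le_trans _ _ (Num.sqrt (\sum_(i < n) (r + r) ^+ 2))); last by rewrite lerDl.
apply: ler_wsqrtr; apply: ler_sum => i _.
rewrite -real_normK ?num_real// ler_sqr ?nnegrE ?addr_ge0//.
rewrite !mxE (le_trans (ler_normB _ _))// lerD//.
  exact: le_trans (rv_norm_coord _ _) (Gr _ Gx).
exact: le_trans (rv_norm_coord _ _) (Gr _ Gy).
Qed.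

Lemma dH_le n (K L : set 'rV[R]_n) d : 0 < d -> K `<=` thicken L d ->
  L `<=` thicken K d -> dH K L <= d.
Proof.
move=> d0 KL LK; apply: ge_inf; last by split.
by exists 0 => e [e0 _]; exact: ltW.
Qed.

(** [d] witnesses that the set under the infimum is nonempty; without it [inf] would take its
    default value 0. *)
Lemma le_dH n (K L : set 'rV[R]_n) b d : 0 < d -> K `<=` thicken L d ->
  L `<=` thicken K d -> (forall e, 0 < e -> K `<=` thicken L e -> b <= e) ->
  b <= dH K L.
Proof.
move=> d0 KL LK H; apply: lb_le_inf; first by exists d.
by move=> e [e0 [KLe _]]; exact: H.
Qed.

(** The common end of the three refutations: a positive power of s tends to 0 with s. *)
Lemma powR_small (c M r s0 : R) : 0 < c -> 0 < r -> 0 < s0 ->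
  ~ (forall s, 0 < s -> s <= s0 -> c <= M * s `^ r).
Proof.
move=> c0 r0 s00 H.
(* Makes (|M| + 1) x equal to c / 2, which is below c. *)
pose x := c / (2 * (`|M| + 1)).
have M1 : 0 < 2 * (`|M| + 1) by rewrite mulr_gt0// ltr_wpDl.
have x0 : 0 < x by rewrite divr_gt0.
pose s := Num.min s0 (x `^ r^-1).
have s_gt0 : 0 < s by rewrite lt_min s00 powR_gt0.
have := H s s_gt0; rewrite ge_min lexx => /(_ isT).
have sx : s `^ r <= x.
  apply: (@le_trans _ _ ((x `^ r^-1) `^ r)).
    by apply: ge0_ler_powR; rewrite ?nnegrE ?powR_ge0 ?(ltW r0) ?(ltW s_gt0)// ge_min lexx orbT.
  by rewrite -powRrM mulVf ?gt_eqF// powRr1// ltW.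
apply/negP; rewrite -ltNge.
apply: (@le_lt_trans _ _ ((`|M| + 1) * x)).
  apply: (@le_trans _ _ ((`|M| + 1) * s `^ r)).
    by rewrite ler_wpM2r ?powR_ge0// (le_trans (ler_norm M))// lerDl.
  by rewrite ler_wpM2l// addr_ge0.
have M0 : `|M| + 1 != 0 by rewrite gt_eqF// ltr_wpDl.
have -> : (`|M| + 1) * x = c / 2 by rewrite /x; field.
by rewrite ltr_pdivrMr// ltr_pMr// ltr1n.
Qed.

Lemma Vol_gt0 n (G : set 'rV[R]_n) : compact G -> interior G !=set0 -> 0 < Vol G.
Proof.
move=> cG [x /nbhs_ballP[r /= r0 rG]].
pose b := box (x - const_mx (r / 2)) (x + const_mx (r / 2)).
have r2 : 0 < r / 2 by rewrite divr_gt0.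
have bG : b `<=` G.
  move=> y yb; apply: rG; rewrite -ball_normE /ball_ /=.
  apply: (@le_lt_trans _ _ (r / 2)); last by rewrite ltr_pdivrMr// ltr_pMr// ltr1n.
  apply/rv_normP => [|i]; first exact: ltW.
  by have := yb i; rewrite !mxE distrC ler_distl.
rewrite -lte_fin VolE//.
apply: (@lt_le_trans _ _ (mu R n (@emb R n @^-1` b))); last first.
  apply: le_measure; rewrite ?inE; [exact: measurable_box|exact: measurable_compact|].
  by move=> w /=; exact: bG.
rewrite mu_box => [|i]; last by rewrite !mxE lerD2l (@le_trans _ _ 0)// ?oppr_le0 ltW.
rewrite lte_fin prodr_gt0// => i _; rewrite !mxE subr_gt0 ltrD2l.
by rewrite (@lt_trans _ _ 0)// oppr_lt0.
Qed.

Lemma dG_lower n (G : set 'rV[R]_n) (beta : R) : (0 < n)%N -> compact G -> convex G ->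
  interior G !=set0 -> 1 < beta ->
  ~ (exists C : R, 0 < C /\ forall K L, in_KG G K -> in_KG G L ->
     dG G K L <= C * dH K L `^ beta).
Proof.
move=> n0 cG vG iG b1 [C [C0 HC]].
have [x0 Gx0] : G !=set0 by have [x /interior_subset] := iG; exists x.
have ccG : cc_body G by split; [exists x0|].
have [D D0 DG] := enorm_diam cG.
have V0 := Vol_gt0 cG iG.
have inG : in_KG G G by split.
apply: (@powR_small (Vol G) (C * D `^ beta) (beta - 1) 1 V0 _ ltr01); first by rewrite subr_gt0.
move=> e e0 e1.
have LG := homothet_sub vG Gx0 (ltW e0) e1.
have ccL := homothet_cc x0 e ccG.
have De0 : 0 < D * e by rewrite mulr_gt0.
have GL : G `<=` thicken (homothet G x0 e) (D * e).
  move=> x Gx; exists ((1 - e) *: x + e *: x0); first by exists x.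
  have -> : x - ((1 - e) *: x + e *: x0) = e *: (x - x0).
    by apply/rowP => i; rewrite !mxE; ring.
  by rewrite enormZ ?(ltW e0)// mulrC ler_wpM2r ?(ltW e0)// DG.
have LG' : homothet G x0 e `<=` thicken G (D * e).
  by move=> x Lx; exists x; [exact: LG|rewrite subrr enorm0 ltW].
have dHe : dH G (homothet G x0 e) <= D * e by exact: dH_le.
have dH0 : 0 <= dH G (homothet G x0 e).
  by apply: (le_dH De0 GL LG') => d d0 _; exact: ltW.
have := HC G (homothet G x0 e) inG (conj ccL LG).
rewrite dG_sub// => H.
have eV : e * Vol G <= C * D `^ beta * e `^ beta.
  apply: (@le_trans _ _ (C * dH G (homothet G x0 e) `^ beta)); last first.
    rewrite -mulrA -powRM ?(ltW D0) ?(ltW e0)// ler_pM2l//.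
    by apply: ge0_ler_powR; rewrite ?nnegrE ?mulr_ge0 ?(ltW D0) ?(ltW e0)// (le_trans ler01)// ltW.
  apply: le_trans H; rewrite big_mkord.
  have E (j : 'I_n.+1) : MVj j G G - MVj j G (homothet G x0 e) = (1 - (1 - e) ^+ j) * Vol G.
    rewrite MVj_homothet//; [|by rewrite -ltnS|exact: ltW].
    (* G is its own homothet with e = 0, which evaluates MV_j(G, G). *)
    have := @MVj_homothet _ n j G x0 0 n0 _ ccG (lexx 0) ler01.
    have -> : homothet G x0 0 = G.
      apply/seteqP; split => y; first by move=> [z Gz <-]; rewrite subr0 scale1r scale0r addr0.
      by move=> Gy; exists y => //; rewrite subr0 scale1r scale0r addr0.
    rewrite subr0 expr1n mul1r mulrBl mul1r => -> //.
    by rewrite -ltnS.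
  under eq_bigr do rewrite E.
  have n1 : (1 < n.+1)%N by [].
  (* The term j = 1 alone equals e Vol G, and the others are nonnegative. *)
  rewrite (bigD1 (Ordinal n1))//= expr1 opprB addrCA subrr addr0 lerDl.
  apply: sumr_ge0 => j _; rewrite mulr_ge0// ?(ltW V0)// subr_ge0.
  by apply: exprn_ile1; rewrite ?subr_ge0// gerBl ltW.
have eE : e `^ beta = e * e `^ (beta - 1).
  rewrite -{2}(powRr1 (ltW e0)) -powRD ?(gt_eqF e0) ?implybT//.
  by rewrite addrCA subrr addr0.
by move: eV; rewrite eE mulrCA ler_pM2l.
Qed.

(** In use, x0 maximises [dotv a] on G, and s is the depth below the supporting hyperplane at x0. *)
Definition cut n (G : set 'rV[R]_n) (a x0 : 'rV[R]_n) (s : R) : set 'rV[R]_n :=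
  G `&` [set x | dotv a (x - x0) <= - s].

Definition cap n (G : set 'rV[R]_n) (a x0 : 'rV[R]_n) (s : R) : set 'rV[R]_n :=
  G `&` [set x | - s <= dotv a (x - x0)].

Lemma continuous_dotv n (a x0 : 'rV[R]_n) : continuous (fun x : 'rV[R]_n => dotv a (x - x0)).
Proof.
apply: (@continuous_bigsum R _ R^o) => i x.
apply: (@continuousM _ _ (fun=> a 0 i)); first exact: cst_continuous.
have -> : (fun x : 'rV[R]_n => (x - x0) 0 i) = (fun x => x 0 i - x0 0 i).
  by apply/funext => y; rewrite !mxE.
apply: (@continuousB R R^o _ (fun u : 'rV[R]_n => u 0 i) (fun=> x0 0 i)).
  exact: coord_continuous.
exact: cst_continuous.
Qed.

Lemma cut_compact n (G : set 'rV[R]_n) a x0 s : compact G -> compact (cut G a x0 s).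
Proof.
move=> cG; apply: compact_closedI => //.
apply: (@preimage_closed _ _ (fun x : 'rV[R]_n => dotv a (x - x0)) [set r | r <= - s] _
  (@closed_le R (- s))) => x _.
exact: continuous_dotv.
Qed.

Lemma cap_compact n (G : set 'rV[R]_n) a x0 s : compact G -> compact (cap G a x0 s).
Proof.
move=> cG; apply: compact_closedI => //.
apply: (@preimage_closed _ _ (fun x : 'rV[R]_n => dotv a (x - x0)) [set r | - s <= r] _
  (@closed_ge R (- s))) => x _.
exact: continuous_dotv.
Qed.

Lemma cut_convex n (G : set 'rV[R]_n) a x0 s : convex G -> convex (cut G a x0 s).
Proof.
move=> vG x y t [Gx xs] [Gy ys] t0 t1; split; first exact: vG.
move: xs ys; rewrite /mkset => xs ys.
have -> : t *: x + (1 - t) *: y - x0 = t *: (x - x0) + (1 - t) *: (y - x0).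
  by apply/rowP => i; rewrite !mxE; ring.
rewrite dotvDr !dotvZr.
have -> : - s = t * - s + (1 - t) * - s by ring.
by rewrite lerD// ler_wpM2l// subr_ge0.
Qed.

Lemma Vol_cut_cap n (G : set 'rV[R]_n) a x0 s : compact G ->
  Vol G - Vol (cut G a x0 s) <= Vol (cap G a x0 s).
Proof.
move=> cG; rewrite lerBlDl -lee_fin EFinD !VolE//; [|exact: cap_compact|exact: cut_compact].
have m1 := measurable_compact (@cut_compact _ G a x0 s cG).
have m2 := measurable_compact (@cap_compact _ G a x0 s cG).
apply: le_trans (measureU2 _ m1 m2); apply: le_measure; rewrite ?inE.
- exact: measurable_compact.
- exact: measurableU.
move=> w Gw; have [h|/ltW h] := leP (dotv a (emb w - x0)) (- s); first by left.
by right.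
Qed.

Lemma stab_const_ge0 n : 0 <= stab_const R n.
Proof. by apply: sumr_ge0 => S _; rewrite exprn_ge0// sumr_ge0. Qed.

(** With L the cut body, x0 has distance at least s / A from L, where A is the l1 norm of a. So a
    cap volume of order s^q rules out every exponent p < q. *)
Lemma dG_cap n (G : set 'rV[R]_n) (a x0 x1 : 'rV[R]_n) (B q p : R) : (0 < n)%N ->
  compact G -> convex G -> G x0 -> G x1 -> dotv a (x1 - x0) < 0 -> 0 < q -> p < q ->
  (forall s, 0 < s -> s <= 1 -> Vol (cap G a x0 s) <= B * s `^ q) ->
  ~ (exists C : R, 0 < C /\ forall K L, in_KG G K -> in_KG G L ->
     C * dH K L `^ p <= dG G K L).
Proof.
move=> n0 cG vG Gx0 Gx1 ax1 q0 pq HB [C [C0 HC]].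
have ccG : cc_body G by split; [exists x0|].
have inG : in_KG G G by split.
have [D D0 DG] := enorm_diam cG.
pose A := \sum_i `|a 0 i|.
have A0 : 0 < A.
  rewrite lt_neqAle sumr_ge0 ?andbT//; apply: contraTneq ax1 => A0.
  rewrite -leNgt; have := dotv_le_enorm a (x1 - x0).
  by rewrite -/A -A0 mul0r normr_le0 => /eqP ->.
pose s1 := - dotv a (x1 - x0).
have s10 : 0 < s1 by rewrite oppr_gt0.
pose k := n.+1%:R * (n`!%:R^-1 * stab_const R n).
have k0 : 0 <= k by rewrite !mulr_ge0 ?invr_ge0 ?stab_const_ge0.
(* s <= s1 keeps x1 in the cut, which is thus nonempty; s <= 1 is the range of the volume bound. *)
have M0 : 0 < Num.min s1 1 by rewrite lt_min s10 ltr01.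
have main s : 0 < s -> s <= Num.min s1 1 ->
    [/\ A^-1 * s <= dH G (cut G a x0 s), dH G (cut G a x0 s) <= D &
     C * dH G (cut G a x0 s) `^ p <= k * B * s `^ q].
  move=> s0; rewrite le_min => /andP[ss1 sle1].
  have LG : cut G a x0 s `<=` G by move=> x [].
  have Lx1 : cut G a x0 s x1 by split => //=; rewrite lerNr.
  have ccL : cc_body (cut G a x0 s).
    by split; [exists x1|split; [exact: cut_compact|exact: cut_convex]].
  have GL : G `<=` thicken (cut G a x0 s) D by move=> x Gx; exists x1 => //; exact: DG.
  have LG' : cut G a x0 s `<=` thicken G D.
    by move=> x [Gx _]; exists x => //; rewrite subrr enorm0 ltW.
  split.
  - apply: (le_dH D0 GL LG') => e e0 /(_ x0 Gx0)[y [Gy ys] xy].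
    rewrite mulrC ler_pdivrMr// mulrC.
    apply: (@le_trans _ _ (A * enorm (x0 - y))); last by rewrite ler_pM2l.
    apply: le_trans (dotv_le_enorm _ _).
    apply: le_trans (ler_norm _).
    have -> : dotv a (x0 - y) = - dotv a (y - x0) by rewrite !dotvBr opprB.
    by rewrite lerNr.
  - exact: dH_le.
  - apply: le_trans (HC _ _ inG (conj ccL LG)) _.
    apply: le_trans (dG_le_Vol n0 ccG ccL LG) _.
    rewrite -/k -mulrA ler_wpM2l//.
    apply: le_trans (Vol_cut_cap _ _ _ cG) _; exact: HB.
(* For negative p the power decreases in the distance, so the upper bound D is used in place of the
   lower bound s / A. *)
have [p0|p0] := leP 0 p.
  apply: (@powR_small (C * A^-1 `^ p) (k * B) (q - p) (Num.min s1 1) _ _ M0).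
  - by rewrite mulr_gt0// powR_gt0 ?invr_gt0.
  - by rewrite subr_gt0.
  move=> s s0 /(main s s0)[sdH _ H].
  have : C * (A^-1 * s) `^ p <= k * B * s `^ q.
    apply: le_trans H; rewrite ler_pM2l//; apply: ge0_ler_powR => //;
    rewrite nnegrE; have As0 : 0 <= A^-1 * s by rewrite mulr_ge0 ?invr_ge0 ?(ltW A0) ?(ltW s0).
      by [].
    exact: le_trans sdH.
  rewrite powRM ?invr_ge0 ?(ltW A0) ?(ltW s0)// mulrA.
  have -> : s `^ q = s `^ (q - p) * s `^ p.
    by rewrite -powRD ?subrK// (gt_eqF s0) implybT.
  by rewrite mulrA ler_pM2r// powR_gt0.
apply: (@powR_small (C * D `^ p) (k * B) q (Num.min s1 1) _ q0 M0).
  by rewrite mulr_gt0// powR_gt0.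
move=> s s0 /(main s s0)[sdH dHD H].
have dH0 : 0 < dH G (cut G a x0 s).
  by apply: lt_le_trans sdH; rewrite mulr_gt0// invr_gt0.
apply: le_trans H; move: (dH _ _) dHD dH0 => h hD h0.
rewrite ler_pM2l// -[p]opprK !(powRN _ (- p)) lef_pV2 ?posrE ?powR_gt0//.
by apply: ge0_ler_powR; rewrite ?nnegrE ?oppr_ge0 ?(ltW p0) ?(ltW D0) ?(ltW h0).
Qed.

End HausdorffBounds.

(** * Volumes of caps *)

Section Caps.
Variable R : realType.

Lemma exists_other_point n (G : set 'rV[R]_n) x0 : (0 < n)%N -> interior G !=set0 ->
  exists2 x1, G x1 & x1 != x0.
Proof.
move=> n0 [x /nbhs_ballP[r /= r0 rG]].
have [xx0|] := eqVneq x x0; last by exists x => //; apply: rG; exact: ballxx.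
have r2 : 0 < r / 2 by rewrite divr_gt0.
exists (x + const_mx (r / 2)).
  apply: rG; rewrite -ball_normE /ball_ /= opprD addrA subrr add0r normrN.
  apply: (@le_lt_trans _ _ (r / 2)); last by rewrite ltr_pdivrMr// ltr_pMr// ltr1n.
  by apply/rv_normP => [|i]; rewrite ?(ltW r2)// mxE gtr0_norm.
apply/eqP => /rowP /(_ (Ordinal n0)); rewrite -xx0 !mxE => /eqP.
by rewrite -subr_eq0 addrAC subrr add0r gt_eqF.
Qed.

(** Cavalieri along the first coordinate: sections over the box lie in intervals of length h. This
    handles slanted slabs without a change of coordinates. *)
Lemma Vol_slab_le n (A : set 'rV[R]_n.+1) (b c : 'rV[R]_n) (g : 'rV[R]_n -> R) h :
  compact A -> 0 <= h -> (forall i, b 0 i <= c 0 i) ->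
  (forall x, A x -> box b c (behv x) /\ g (behv x) <= x 0 ord0 <= g (behv x) + h) ->
  Vol A <= h * \prod_i (c 0 i - b 0 i).
Proof.
move=> cA h0 bc HA; rewrite -lee_fin VolE//.
have mA := measurable_compact cA.
have mB : measurable (@emb R n @^-1` box b c) by exact: measurable_box.
pose f (z : sp R n.+1) := (\1_(@emb R n.+1 @^-1` A) z)%:E : \bar R.
have mf : measurable_fun setT f by apply/measurable_EFinP; exact: measurable_indic.
have f0 z : (0 <= f z)%E by rewrite lee_fin.
have -> : mu R n.+1 (@emb R n.+1 @^-1` A) = (\int[mu R n.+1]_z f z)%E.
  by rewrite integral_indic// setIT.
rewrite (fubini_tonelli2 (m1 := lebesgue_measure) (m2 := mu R n) f)//.
have IB : mu R n (@emb R n @^-1` box b c) =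
    (\int[mu R n]_w (\1_(@emb R n @^-1` box b c) w)%:E)%E.
  by rewrite integral_indic// setIT.
have m1B : measurable_fun setT (fun w => (\1_(@emb R n @^-1` box b c) w)%:E : \bar R).
  by apply/measurable_EFinP; exact: measurable_indic.
rewrite EFinM -mu_box// IB -ge0_integralZl//.
apply: ge0_le_integral => //.
- by move=> w _; apply: integral_ge0.
- exact: (measurable_fun_fubini_tonelli_G (m1 := lebesgue_measure) f).
- exact: measurable_funeM.
move=> w _; rewrite /fubini_G.
have [wB|wB] := pselect (box b c (emb w)); last first.
  rewrite integral0_eq => [|x _]; first by rewrite mule_ge0 ?lee_fin.
  rewrite /f indicE memNset// => /HA[]; by rewrite consvK.
rewrite indicE mem_set// mule1.
apply: (@le_trans _ _ (\int[@lebesgue_measure R]_x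
    (\1_(`[g (emb w), g (emb w) + h]%classic) x)%:E)%E).
  apply: ge0_le_integral => //.
  - exact: (measurableT_comp mf (pair2_measurable w)).
  - by apply/measurable_EFinP; apply: measurable_indic; exact: measurable_itv.
  move=> x _; rewrite lee_fin !indicE ler_nat.
  have [xA|//] := boolP ((x, w) \in _).
  rewrite mem_set //= in_itv /=; move: xA; rewrite inE /= => /HA[_].
  by rewrite consvK consv0.
rewrite integral_indic// ?setIT.
rewrite [leLHS](@lebesgue_measure_itv R) /= lte_fin.
case: ifP => _; last by rewrite lee_fin.
by rewrite -EFinD lee_fin addrAC subrr add0r.
Qed.

(** For the quadratic f below, f(x) - f(x0) is exactly a.(x - x0) + |x - x0|^2, so the claim is the
    maximality of x0. *)
Lemma paraboloid_contact n (G : set 'rV[R]_n.+1) : compact G -> G !=set0 ->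
  exists x0 a : 'rV[R]_n.+1, [/\ G x0, 0 < a 0 ord0 &
    forall x, G x -> dotv a (x - x0) <= - \sum_i (x - x0) 0 i ^+ 2].
Proof.
move=> cG G0; have [M [Mr MG]] := compact_bounded cG.
pose r := `|M| + 1.
have Gr x : G x -> `|x| <= r.
  by move=> Gx; apply: MG => //; rewrite (le_lt_trans (ler_norm M))// ltrDl.
(* Twice a coordinate of a point of G is at most 2r in absolute value, so the first entry of [a] is
   at least 1. *)
pose K := 2 * r + 1.
pose f (x : 'rV[R]_n.+1) := K * x 0 ord0 + \sum_i x 0 i ^+ 2.
have cf : continuous f.
  move=> x; apply: (@continuousD _ _ _ (fun x : 'rV[R]_n.+1 => K * x 0 ord0)
    (fun x => \sum_i x 0 i ^+ 2)).
    by apply: (@continuousM _ _ (fun=> K)); [exact: cst_continuous|exact: coord_continuous].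
  apply: (@continuous_bigsum R _ R^o) => i; apply: continuous_sqr.
  exact: coord_continuous.
have [x0] := compact_EVT_max G0 cG (continuous_subspaceT cf).
rewrite inE => Gx0 x0max.
(* The gradient of [f] at [x0]. *)
pose a : 'rV[R]_n.+1 := \row_i (K * (i == ord0)%:R + 2 * x0 0 i).
exists x0, a; split => //.
  rewrite mxE eqxx mulr1 /K.
  have := le_trans (rv_norm_coord x0 ord0) (Gr _ Gx0); rewrite ler_norml => /andP[]; lra.
move=> x Gx; have := x0max x; rewrite inE => /(_ Gx).
rewrite -subr_ge0 => H; rewrite -subr_ge0; apply: le_trans H _.
have -> : dotv a (x - x0) = K * (x - x0) 0 ord0 + \sum_i 2 * x0 0 i * (x - x0) 0 i.
  rewrite /dotv (eq_bigr (fun i => K * (i == ord0)%:R * (x - x0) 0 i + 2 * x0 0 i * (x - x0) 0 i)).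
    rewrite big_split /=; congr (_ + _).
    by rewrite (bigD1 ord0)//= ?eqxx ?mulr1 big1 ?addr0// => i /negbTE ->; rewrite mulr0 mul0r.
  by move=> i _; rewrite [a _ _]mxE mulrDl.
rewrite /f -subr_ge0 le_eqVlt; apply/orP; left; apply/eqP/esym.
set A := \sum_i (x - x0) 0 i ^+ 2; set B := \sum_i 2 * _ * _.
have : \sum_i x 0 i ^+ 2 = \sum_i x0 0 i ^+ 2 + B + A.
  rewrite /A /B -!big_split; apply: eq_bigr => i _ /=; rewrite !mxE; ring.
move=> ->; rewrite !mxE; ring.
Qed.

Lemma powR_cap_exponent n (s : R) : 0 < s ->
  (Num.sqrt s) ^+ n * s = s `^ ((n.+1%:R + 1) / 2).
Proof.
move=> s0; rewrite -powR12_sqrt ?(ltW s0)// -powR_mulrn ?powR_ge0// -powRrM.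
rewrite -{2}(powRr1 (ltW s0)) -powRD; last by rewrite (gt_eqF s0) implybT.
by congr (_ `^ _); rewrite -natr1; field.
Qed.

(** On the cap |x - x0|^2 <= s, so the last n coordinates stay in a box of side 2 sqrt(s), while -s
    <= a.(x - x0) <= 0 leaves an interval of length s / a_0 for the first one. *)
Lemma Vol_cap_paraboloid n (G : set 'rV[R]_n.+1) (x0 a : 'rV[R]_n.+1) s :
  compact G -> 0 < a 0 ord0 ->
  (forall x, G x -> dotv a (x - x0) <= - \sum_i (x - x0) 0 i ^+ 2) -> 0 < s ->
  Vol (cap G a x0 s) <= 2 ^+ n / a 0 ord0 * s `^ ((n.+1%:R + 1) / 2).
Proof.
move=> cG a0 Ga s0.
have r0 : 0 <= Num.sqrt s by exact: sqrtr_ge0.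
pose g (y : 'rV[R]_n) := x0 0 ord0 - (s + dotv (behv a) (y - behv x0)) / a 0 ord0.
have := @Vol_slab_le _ _ (behv x0 - const_mx (Num.sqrt s))
   (behv x0 + const_mx (Num.sqrt s)) g (s / a 0 ord0)
   (@cap_compact _ _ G a x0 s cG).
rewrite divr_ge0 ?(ltW s0) ?(ltW a0)// => /(_ isT) H.
apply: le_trans (H _ _) _.
- by move=> i; rewrite !mxE lerD2l (@le_trans _ _ 0)// oppr_le0.
- move=> x [Gx /= xs]; have := Ga x Gx => xle; split.
    move=> i; rewrite !mxE -ler_distl -ler_sqr ?nnegrE// sqr_sqrtr ?(ltW s0)//.
    rewrite real_normK ?num_real//.
    have := sqsum_ge (x - x0) (lift ord0 i); rewrite !mxE => /le_trans; apply.
    by rewrite -lerN2 (le_trans xs).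
  have E : dotv a (x - x0) = a 0 ord0 * (x 0 ord0 - x0 0 ord0) + dotv (behv a) (behv x - behv x0).
    rewrite /dotv big_ord_recl; congr (_ + _); first by rewrite !mxE.
    by apply: eq_bigr => i _; rewrite !mxE.
  have d0 : dotv a (x - x0) <= 0.
    by apply: le_trans xle _; rewrite oppr_le0 sumr_ge0// => i _; exact: sqr_ge0.
  have ax : x 0 ord0 = x0 0 ord0 + (dotv a (x - x0) - dotv (behv a) (behv x - behv x0)) / a 0 ord0.
    rewrite E addrK mulrAC divff ?gt_eqF// mul1r; ring.
  rewrite {1 2}ax /g; apply/andP; split.
    rewrite lerD2l -mulNr ler_pM2r ?invr_gt0// opprD lerD2r.
    exact: xs.
  rewrite -addrA lerD2l -mulNr -mulrDl ler_pM2r ?invr_gt0//.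
  by move: d0; lra.
have -> : \prod_i ((behv x0 + const_mx (Num.sqrt s)) 0 i -
    (behv x0 - const_mx (Num.sqrt s)) 0 i) = (2 * Num.sqrt s) ^+ n.
  rewrite (eq_bigr (fun=> 2 * Num.sqrt s)) ?prodr_const ?card_ord// => i _.
  rewrite !mxE; ring.
rewrite -powR_cap_exponent// exprMn le_eqVlt; apply/orP; left; apply/eqP; ring.
Qed.

Lemma dotvC n (x y : 'rV[R]_n) : dotv x y = dotv y x.
Proof. by apply: eq_bigr => i _; rewrite mulrC. Qed.

(** [v] is a generator of largest Euclidean norm and [a] the gradient of the squared norm there:
    2v.(u - v) = |u|^2 - |v|^2 - |u - v|^2 <= -|u - v|^2 for each generator u. Separation of the
    generators from v replaces one factor |u - v| by d, and the bound then passes to convex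
    combinations by the triangle inequality. *)
Lemma polytope_vertex n (s : seq 'rV[R]_n) : conv_hull_seq s !=set0 ->
  exists (v a : 'rV[R]_n) (d : R), [/\ conv_hull_seq s v, 0 < d &
    forall x, conv_hull_seq s x -> dotv a (x - v) <= - (d * `|x - v|)].
Proof.
move=> [x [w [_ [w1 _]]]].
have [v vs vmax] : exists2 v, v \in s & forall u, u \in s -> dotv u u <= dotv v v.
  have : s != [::] by apply: contra_eq_neq w1 => ->; rewrite big_nil eq_sym oner_neq0.
  elim: s {x w w1} => // u s IH _.
  have [->|/IH[v vs vmax]] := eqVneq s [::].
    by exists u; rewrite ?mem_head// => y; rewrite inE => /eqP ->.
  have [uv|vu] := leP (dotv u u) (dotv v v).
    exists v; rewrite ?inE ?vs ?orbT// => y; rewrite inE => /orP[/eqP -> //|]; exact: vmax.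
  exists u; rewrite ?mem_head// => y; rewrite inE => /orP[/eqP -> //|/vmax yv].
  exact: le_trans yv (ltW vu).
have [d d0 dP] : exists2 d : R, 0 < d & forall u, u \in s -> u != v -> d <= `|u - v|.
  elim: s {x w w1 vs vmax} => [|u s [d d0 dP]]; first by exists 1.
  have [uv|uv] := eqVneq u v.
    exists d => // y; rewrite inE => /orP[/eqP ->|]; last exact: dP.
    by rewrite uv eqxx.
  exists (Num.min d `|u - v|); first by rewrite lt_min d0 normr_gt0 subr_eq0.
  move=> y; rewrite inE => /orP[/eqP ->|ys] yv; rewrite ge_min ?lexx ?orbT//.
  by rewrite dP.
(* Weights are functions of the point, so every copy of v in the list carries the same one; hence
   the division by the multiplicity. *)
have W1 : \sum_(u <- s) (u == v)%:R / (count_mem v s)%:R = 1 :> R.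
  rewrite -mulr_suml -natr_sum.
  have -> : (\sum_(u <- s) (u == v) = count_mem v s)%N.
    by rewrite -sum1_count [RHS]big_mkcond; apply: eq_bigr => u _ /=; case: eqP.
  by rewrite divff// pnatr_eq0 -lt0n -has_count has_pred1.
exists v, (2 *: v), d; split => //.
  exists (fun u => (u == v)%:R / (count_mem v s)%:R); split; last split.
  - by move=> u; rewrite divr_ge0.
  - exact: W1.
  - transitivity (\sum_(u <- s) ((u == v)%:R / (count_mem v s)%:R : R) *: v).
      by rewrite -scaler_suml W1 scale1r.
    apply: eq_bigr => u _; have [->//|_] := eqVneq u v.
    by rewrite mul0r !scale0r.
move=> {W1} _ [W [W0 [W1 ->]]].
have -> : \sum_(u <- s) W u *: u - v = \sum_(u <- s) W u *: (u - v).
  under [RHS]eq_bigr do rewrite scalerBr.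
  by rewrite sumrB -scaler_suml W1 scale1r.
rewrite dotv_sumr.
apply: (@le_trans _ _ (\sum_(u <- s) - (d * (W u * `|u - v|)))).
  rewrite big_seq [leRHS]big_seq; apply: ler_sum => u us.
  rewrite dotvZr mulrCA -mulrN ler_wpM2l//.
  have [->|uv] := eqVneq u v; first by rewrite dotvBr !subrr normr0 mulr0 oppr0.
  have -> : dotv (2 *: v) (u - v) = dotv u u - dotv v v - dotv (u - v) (u - v).
    rewrite !dotvZl !dotvBl !dotvBr (dotvC u v); ring.
  rewrite -[leRHS]add0r lerD ?subr_le0 ?vmax// lerN2.
  apply: (@le_trans _ _ (enorm (u - v) * enorm (u - v))).
    have uve : `|u - v| <= enorm (u - v).
      by apply/rv_normP => [|i]; [exact: sqrtr_ge0|exact: coord_le_enorm].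
    by rewrite ler_pM// ?(ltW d0)// (le_trans _ uve)// dP.
  by rewrite -expr2 sqr_sqrtr ?sumr_ge0// => i _; exact: sqr_ge0.
rewrite sumrN lerN2 -mulr_sumr ler_pM2l//.
rewrite (le_trans (ler_norm_sum _ _ _))//; apply: ler_sum => u _.
by rewrite normrZ ger0_norm.
Qed.

(** The cap lies in the sup-norm ball of radius s / d about v. *)
Lemma Vol_cap_vertex n (G : set 'rV[R]_n) (v a : 'rV[R]_n) d s :
  compact G -> 0 < d -> (forall x, G x -> dotv a (x - v) <= - (d * `|x - v|)) -> 0 < s ->
  Vol (cap G a v s) <= (2 / d) ^+ n * s `^ n%:R.
Proof.
move=> cG d0 Ga s0.
have sd : 0 < s / d by rewrite divr_gt0.
have cC := @cap_compact _ _ G a v s cG.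
rewrite -lee_fin VolE//.
apply: (@le_trans _ _ (mu R n (@emb R n @^-1` box (v - const_mx (s / d)) (v + const_mx (s / d))))).
  apply: le_measure; rewrite ?inE; [exact: measurable_compact|exact: measurable_box|].
  move=> w [/Ga Gw /= ws] i; rewrite !mxE -ler_distl.
  have := rv_norm_coord (emb w - v) i; rewrite !mxE => /le_trans; apply.
  by rewrite ler_pdivlMr// mulrC -lerN2 (le_trans ws).
rewrite mu_box => [|i]; last by rewrite !mxE lerD2l (@le_trans _ _ 0)// ?oppr_le0 ltW.
rewrite lee_fin (eq_bigr (fun=> 2 / d * s)) => [|i _]; last by rewrite !mxE; ring.
by rewrite prodr_const card_ord exprMn powR_mulrn// ltW.
Qed.

End Caps.

Theorem theorem1p3 (R : realType) (n : nat) (G : set 'rV[R]_n) :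
  (0 < n)%N -> compact G -> convex G -> interior G !=set0 ->
  (forall beta : R, 1 < beta ->
     ~ (exists C : R, 0 < C /\
          forall K L, in_KG G K -> in_KG G L ->
            dG G K L <= C * dH K L `^ beta)) /\
  (forall p : R, p < (n%:R + 1) / 2 ->
     ~ (exists C : R, 0 < C /\
          forall K L, in_KG G K -> in_KG G L ->
            C * dH K L `^ p <= dG G K L)) /\
  (polytope G ->
   forall p : R, p < n%:R ->
     ~ (exists C : R, 0 < C /\
          forall K L, in_KG G K -> in_KG G L ->
            C * dH K L `^ p <= dG G K L)).
Proof.
move=> n0 cG vG iG.
have G0 : G !=set0 by have [x /interior_subset] := iG; exists x.
split; [|split].
- by move=> beta; exact: dG_lower.
- case: n n0 G cG vG iG G0 => // n n0 G cG vG iG G0 p pn.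
  have [x0 [a [Gx0 a0 Ga]]] := paraboloid_contact cG G0.
  have [x1 Gx1 x10] := exists_other_point x0 n0 iG.
  apply: (dG_cap n0 cG vG Gx0 Gx1 _ _ pn) => [||s s0 _].
  + apply: le_lt_trans (Ga _ Gx1) _; rewrite oppr_lt0.
    rewrite lt_neqAle sumr_ge0 ?andbT => [|i _]; last exact: sqr_ge0.
    apply: contra x10; rewrite eq_sym psumr_eq0 => [/allP H|i _]; last exact: sqr_ge0.
    rewrite -subr_eq0; apply/eqP/rowP => i; apply/eqP.
    by have := H i (mem_index_enum i); rewrite sqrf_eq0 [X in _ -> _ == X]mxE.
  + by rewrite divr_gt0// ltr_wpDl.
  + exact: Vol_cap_paraboloid.
- move=> [s GE] p pn; rewrite GE in G0.
  have [v [a [d [Gv d0 Ga]]]] := polytope_vertex G0; rewrite -GE in Gv Ga.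
  have [x1 Gx1 x1v] := exists_other_point v n0 iG.
  apply: (dG_cap n0 cG vG Gv Gx1 _ _ pn) => [||e e0 _].
  + apply: le_lt_trans (Ga _ Gx1) _.
    by rewrite oppr_lt0 mulr_gt0// normr_gt0 subr_eq0.
  + by rewrite ltr0n.
  + exact: (Vol_cap_vertex cG d0 Ga e0).
Qed.
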